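(* Let $n\ge 0$, $p\ge1$, and suppose $\varphi$ is a Weyl function of the discrete system $$W_{k+1}(\lambda)-W_k(\lambda)=-\frac{i}{\lambda}C_kW_k(\lambda),\qquad C_k=C_k^*=C_k^{-1},\qquad 0\le k\le n,$$ where $$C_k=I_{2p}-2\beta(k)^*\beta(k),\qquad \beta(k)\beta(k)^*=I_p\qquad(0\le k\le n),$$ with $p\times 2p$ matrices $\beta(k)=[\beta_1(k)\quad\beta_2(k)]$ ($p\times p$ blocks) satisfying $$\det\beta_1(0)\ne0,\qquad \det\big(\beta(k-1)\beta(k)^*\big)\ne0\quad(0<k\le n).$$ Then the system is uniquely recovered from the first $n+1$ Taylor coefficients $\{\alpha_k\}_{k=0}^n$ of $\varphi\big(i\,\frac{1+z}{1-z}\big)$ at $z=0$ by the following procedure. First introduce the $(n+1)p\times p$ matrices $$\Phi_1=\begin{bmatrix} I_p \\ I_p \\ \cdots \\ I_p \end{bmatrix},\qquad \Phi_2=-\begin{bmatrix} \alpha_0 \\ \alpha_0+\alpha_1 \\ \cdots \\ \alpha_0+\alpha_1+\dots+\alpha_n \end{bmatrix}.$$ Then introduce the $(n+1)p\times2p$ matrix $\Pi=[\Phi_1\quad\Phi_2]$ and the $(n+1)p\times(n+1)p$ block lower triangular matrix $A=A(n)$ whose $p\times p$ blocks are $\frac i2I_p$ on the main diagonal, $iI_p$ below the main diagonal and $0$ above it. Next, the $(n+1)p\times(n+1)p$ matrix $S$ is recovered as the unique solution of the matrix identity $$AS-SA^*=i\Pi\Pi^*.$$ This solution is invertible and positive,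 i.e. $S>0$. Finally, the matrices $\beta(k)^*\beta(k)$ are easily recovered from the formula $$\Pi^*S^{-1}\Pi=B^*B,\qquad B=B(n)=\begin{bmatrix} \beta(0) \\ \beta(1) \\ \cdots \\ \beta(n) \end{bmatrix},$$ and then the matrices $C_k$ and the system are defined via $C_k=I_{2p}-2\beta(k)^*\beta(k)$.
   Context: **Weyl functions of the discrete system on $0\le k\le n$.** Let $W_k(\lambda)$ be the $2p\times2p$ solution of the system normalized by $W_0(\lambda)=I_{2p}$, and put $\mathcal W(\lambda)=\{\mathcal W_{ij}(\lambda)\}_{i,j=1}^2=W_{n+1}(\overline\lambda)^*$, with $p\times p$ blocks $\mathcal W_{ij}$. A pair $R,Q$ of $p\times p$ matrix functions analytic in a neighborhood of $\lambda=i$ is called admissible if $\det\big(\mathcal W_{21}(i)R(i)+\mathcal W_{22}(i)Q(i)\big)\ne0$. The Weyl functions of the system are the matrix functions (considered near $\lambda=i$) $$\varphi(\lambda)=\big(\mathcal W_{11}(\lambda)R(\lambda)+\mathcal W_{12}(\lambda)Q(\lambda)\big)\big(\mathcal W_{21}(\lambda)R(\lambda)+\mathcal W_{22}(\lambda)Q(\lambda)\big)^{-1}$$ with $R,Q$ admissible. Here $I_m$ denotes the $m\times m$ identity matrix. *)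

(* Defs.v *)
From HB Require Import structures.
From mathcomp Require Import all_boot all_order all_algebra.
From mathcomp Require Import complex.
From mathcomp Require Import all_classical all_reals all_analysis.

Set Implicit Arguments.
Unset Strict Implicit.
Unset Printing Implicit Defensive.

Import Order.TTheory GRing.Theory Num.Theory.
Import numFieldNormedType.Exports.

Local Open Scope classical_set_scope.
Local Open Scope sesquilinear_scope.
Local Open Scope ring_scope.

(* MathComp-Analysis equips every abstract [numFieldType] with its norm
   topology but declares no such instance on [R[i]] itself.  The definitions
   are therefore stated over a [numClosedFieldType] K, to be instantiated with
   K := R[i]. *)
Section Defs.
Variable K : numClosedFieldType.

Section Analytic.
Variables p q : nat.

(* The a k are the Taylor coefficients of f at z0: the power series with
   these coefficients converges to f on a neighborhood of z0. *)
Definition taylor_expansion (f : K -> 'M[K]_(p, q)) (z0 : K)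
    (a : nat -> 'M[K]_(p, q)) : Prop :=
  \forall z \near z0,
    series (fun k => (z - z0) ^+ k *: a k) @ \oo --> f z.

Definition analytic_at (f : K -> 'M[K]_(p, q)) (z0 : K) : Prop :=
  exists a, taylor_expansion f z0 a.

Definition analytic_near (f : K -> 'M[K]_(p, q)) (z0 : K) : Prop :=
  \forall z \near z0, analytic_at f z.

End Analytic.

Definition posdefmx m (S : 'M[K]_m) : Prop :=
  S \is hermsymmx /\
  forall x : 'cV[K]_m, x != 0 -> 0 < (x ^t* *m S *m x) 0 0.

Definition cayley (z : K) : K := 'i * ((1 + z) / (1 - z)).

Section System.
Variables n p : nat.

(* Only the values C k and beta k with k <= n are relevant. *)
Definition discrete_system (C : nat -> 'M[K]_(p + p))
    (beta : nat -> 'M[K]_(p, p + p)) : Prop :=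
  [/\ forall k, (k <= n)%N ->
        [/\ C k \is hermsymmx, C k \in unitmx & invmx (C k) = C k],
      forall k, (k <= n)%N -> C k = 1%:M - 2 *: ((beta k) ^t* *m beta k),
      forall k, (k <= n)%N -> beta k *m (beta k) ^t* = 1%:M,
      \det (lsubmx (beta 0%N)) != 0
    & forall k, (0 < k)%N -> (k <= n)%N ->
        \det (beta k.-1 *m (beta k) ^t*) != 0].

Fixpoint fundamental_solution (C : nat -> 'M[K]_(p + p)) (k : nat)
    (lambda : K) : 'M[K]_(p + p) :=
  if k is k'.+1 then
    fundamental_solution C k' lambda
    - ('i / lambda) *: (C k' *m fundamental_solution C k' lambda)
  else 1%:M.

Definition calW (C : nat -> 'M[K]_(p + p)) (lambda : K) : 'M[K]_(p + p) :=
  (fundamental_solution C n.+1 (lambda^*)) ^t*.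

Definition weyl_num (C : nat -> 'M[K]_(p + p)) (R Q : K -> 'M[K]_p)
    (lambda : K) : 'M[K]_p :=
  ulsubmx (calW C lambda) *m R lambda + ursubmx (calW C lambda) *m Q lambda.

Definition weyl_den (C : nat -> 'M[K]_(p + p)) (R Q : K -> 'M[K]_p)
    (lambda : K) : 'M[K]_p :=
  dlsubmx (calW C lambda) *m R lambda + drsubmx (calW C lambda) *m Q lambda.

Definition admissible (C : nat -> 'M[K]_(p + p)) (R Q : K -> 'M[K]_p) : Prop :=
  [/\ analytic_near R 'i, analytic_near Q 'i
    & \det (weyl_den C R Q 'i) != 0].

Definition weyl_function (C : nat -> 'M[K]_(p + p)) (phi : K -> 'M[K]_p) :
    Prop :=
  exists R Q, admissible C R Q /\
    \forall lambda \near ('i : K),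
      phi lambda = weyl_num C R Q lambda *m invmx (weyl_den C R Q lambda).

End System.

Section Recovery.
Variables m p : nat.

Definition Phi1 : 'M[K]_(\sum_(i < m.+1) p, p) :=
  \mxcol_(i < m.+1) (1%:M : 'M[K]_p).

Definition Phi2 (alpha : nat -> 'M[K]_p) : 'M[K]_(\sum_(i < m.+1) p, p) :=
  - (\mxcol_(i < m.+1) (\sum_(0 <= j < i.+1) alpha j)).

Definition Pimx (alpha : nat -> 'M[K]_p) : 'M[K]_(\sum_(i < m.+1) p, p + p) :=
  row_mx Phi1 (Phi2 alpha).

Definition Amx : 'M[K]_(\sum_(i < m.+1) p) :=
  \mxblock_(i < m.+1, j < m.+1)
    ((if i == j then 'i / 2 else if (j < i)%N then 'i else 0)%:M : 'M[K]_p).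

Definition Bmx (beta : nat -> 'M[K]_(p, p + p)) :
    'M[K]_(\sum_(i < m.+1) p, p + p) :=
  \mxcol_(i < m.+1) (beta i).

Definition S_identity (alpha : nat -> 'M[K]_p)
    (S : 'M[K]_(\sum_(i < m.+1) p)) : Prop :=
  Amx *m S - S *m Amx ^t* = 'i *: (Pimx alpha *m (Pimx alpha) ^t*).

End Recovery.
End Defs.

(* Main.v *)
Require Import Defs.
From HB Require Import structures.
From mathcomp Require Import all_boot all_order all_algebra.
From mathcomp Require Import complex.
From mathcomp Require Import all_classical all_reals all_analysis.
From mathcomp Require Import ring.

Set Implicit Arguments.
Unset Strict Implicit.
Unset Printing Implicit Defensive.

Import Order.TTheory GRing.Theory Num.Theory.
Import numFieldNormedType.Exports.

Local Open Scope sesquilinear_scope.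
Local Open Scope ring_scope.

(* Put lambda = i(1+z)/(1-z).  Up to a scalar, each factor of calW becomes
   M_j(z) = (1 - b_j^* b_j) + z b_j^* b_j, so that [phi; I] = M_0 ... M_n X with
   X analytic at z = 0, by admissibility.  The row e = [I, -phi] annihilates
   [phi; I], and comparing ranks at z = 0 shows inductively that
   e M_0 ... M_{j-1} is divisible by z^j.  Let V have as its (k, j) block the
   coefficient of z^k in e M_0 ... M_{j-1} b_j^*.  Then V is block lower
   triangular and invertible, V B = Pi, and A V = V A' for an explicit A' with
   A' - A'^* = i B B^*.  Hence S = V V^* > 0 solves A S - S A^* = i Pi Pi^*, and
   Pi^* S^-1 Pi = B^* B; the solution is unique because A and A^* have the
   disjoint spectra {i/2} and {-i/2}. *)

(** * Recovery from a power series factorization *)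

Section BlaschkeFactors.
Variables (K : numClosedFieldType) (p : nat).
Implicit Types (b : 'M[K]_(p, p + p)) (beta : nat -> 'M[K]_(p, p + p)).

(** Write e_j for e M_0 ... M_{j-1} and Q_j for b_j^* b_j. Since M_j = 1 - (1 - z) Q_j, one has e_j
    - e_{j+1} = (1 - z) e_j Q_j. Telescoping and dividing by 1 - z gives e / (1 - z) = sum_l e_l Q_l
    modulo z^(m+1), because the end row e_{m+1} is divisible by z^(m+1). Division by 1 - z takes
    partial sums of coefficients, hence the shape of Phi_1 and Phi_2, and the identity reads V B =
    Pi. Likewise A is multiplication by (i/2)(1 + z)/(1 - z) on truncated power series, and M_j
    b_j^* = z b_j^* with the same telescoping expresses A V through V, which dictates A'. The
    obstacle is analytic: K is assumed neither complete nor Archimedean, so power series cannot be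
    summed to build X. Germs are handled instead through polynomials of bounded norm that
    approximate to every order, and only formal coefficients are passed on to the algebra. The
    Archimedean property of R[i] enters only in the convergence of the Taylor series of phi(cayley
    z). *)

Lemma adjmx_mul m n q (A : 'M[K]_(m, n)) (B : 'M[K]_(n, q)) :
  (A *m B) ^t* = B ^t* *m A ^t*.
Proof. by rewrite trmx_mul map_mxM. Qed.

Lemma conj_half_i : ('i / 2 : K)^* = - ('i / 2).
Proof. by rewrite rmorphM /= conjCi fmorphV /= conjC_nat mulNr. Qed.

Lemma map_mxblock m1 m2 (f : K -> K) (F : 'I_m1 -> 'I_m2 -> 'M[K]_p) :
  map_mx f (\mxblock_(k < m1, j < m2) F k j)
  = \mxblock_(k < m1, j < m2) map_mx f (F k j).
Proof. by apply/matrixP => r c; rewrite !mxE. Qed.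

Lemma map_mxrow m1 m2 (f : K -> K) (F : 'I_m1 -> 'M[K]_(m2, p)) :
  map_mx f (\mxrow_(k < m1) F k) = \mxrow_(k < m1) map_mx f (F k).
Proof. by apply/matrixP => r c; rewrite !mxE. Qed.

(** Block (k, j) of the equation involves only blocks (l, j) with l <= k and (k, l) with l <= j, and
    (k, j) itself enters with coefficient i/2 + i/2 = i. Induction on k + j kills every block. *)
Lemma Sylvester_Amx_inj m (S : 'M[K]_(\sum_(i < m.+1) p)) :
  Amx K m p *m S - S *m (Amx K m p)^t* = 0 -> S = 0.
Proof.
pose c (k l : 'I_m.+1) : K := if k == l then 'i / 2 else if (l < k)%N then 'i else 0.
have AE : Amx K m p = \mxblock_(k < m.+1, l < m.+1) ((c k l)%:M : 'M[K]_p) by [].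
rewrite -[S]submxblockK; set s := submxblock S; rewrite AE.
rewrite tr_mxblock map_mxblock !mul_mxblock -mxblockB => /mxblockP eqS.
apply/mxblockP => k j; rewrite mxblockK submxblock0.
have [d] := ubnP (k + j)%N; elim: d k j => // d IH k j kj.
have := eqS k j; rewrite mxblockK submxblock0.
rewrite (bigD1 k)//= big1 ?addr0 => [|l lk]; last first.
  rewrite mul_scalar_mx /c eq_sym (negPf lk); case: ltnP => [lk'|]; last by rewrite scale0r.
  by rewrite IH ?scaler0// (leq_trans _ (kj : (k + j <= d)%N))// ltn_add2r.
rewrite (bigD1 j)//= big1 ?addr0 => [|l lj]; last first.
  rewrite tr_scalar_mx map_scalar_mx mul_mx_scalar /c eq_sym (negPf lj) /=.
  case: ltnP => [lj'|]; last by rewrite conjC0 scale0r.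
  by rewrite IH ?scaler0// (leq_trans _ (kj : (k + j <= d)%N))// ltn_add2l.
rewrite tr_scalar_mx map_scalar_mx mul_mx_scalar mul_scalar_mx /c !eqxx /= conj_half_i.
rewrite scaleNr opprK -scalerDl -splitr => /eqP.
by rewrite scaler_eq0 (negPf (neq0Ci _)) => /eqP.
Qed.

(* Coefficient sequence of the product of a power series with
   [(1 - b^* b) + z b^* b], on the left (mulBl) and on the right (mulBr). *)
Definition mulBl b q (x : nat -> 'M[K]_(p + p, q)) (k : nat) : 'M[K]_(p + p, q) :=
  (1%:M - b ^t* *m b) *m x k + (if k is k'.+1 then b ^t* *m b *m x k' else 0).

Definition mulBr b m (u : nat -> 'M[K]_(m, p + p)) (k : nat) : 'M[K]_(m, p + p) :=
  u k *m (1%:M - b ^t* *m b) + (if k is k'.+1 then u k' *m (b ^t* *m b) else 0).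

Definition convmx m q (u : nat -> 'M[K]_(m, p + p)) (x : nat -> 'M[K]_(p + p, q)) k :=
  \sum_(i < k.+1) u i *m x (k - i)%N.

(** Associativity of formal multiplication: one factor passes from the row to the column. *)
Lemma convmx_mulB b m q (u : nat -> 'M[K]_(m, p + p))
    (x : nat -> 'M[K]_(p + p, q)) k :
  convmx (mulBr b u) x k = convmx u (mulBl b x) k.
Proof.
rewrite /convmx /mulBr /mulBl.
under eq_bigr do rewrite mulmxDl.
under [RHS]eq_bigr do rewrite mulmxDr.
rewrite !big_split /=; congr (_ + _).
  by apply: eq_bigr => i _; rewrite mulmxA.
rewrite big_ord_recl big_ord_recr /= mul0mx add0r subnn mulmx0 addr0.
apply: eq_bigr => i _; have ik := ltn_ord i.
by rewrite /bump leq0n add1n subnS -(subnSK ik) -!mulmxA.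
Qed.

Fixpoint mulBs beta q (k : nat) (x : nat -> 'M[K]_(p + p, q)) :=
  if k is k'.+1 then mulBs beta k' (mulBl (beta k') x) else x.

Fixpoint mulsB beta (e : nat -> 'M[K]_(p, p + p)) (j : nat) :=
  if j is j'.+1 then mulBr (beta j') (mulsB beta e j') else e.

Lemma convmx_mulsB beta q e k (x : nat -> 'M[K]_(p + p, q)) l :
  convmx (mulsB beta e k) x l = convmx e (mulBs beta k x) l.
Proof. by elim: k x l => //= k IH x l; rewrite convmx_mulB IH. Qed.

(** Applied when the product is [phi; I], whose constant term has lower block I: the lower rows of
    [A] are then a left inverse of [x 0]. *)
Lemma mulBs_at0 beta q k : exists A : 'M[K]_(p + p),
  forall x : nat -> 'M[K]_(p + p, q), mulBs beta k x 0%N = A *m x 0%N.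
Proof.
elim: k => [|k [A IH]]; first by exists 1%:M => x; rewrite mul1mx.
exists (A *m (1%:M - (beta k) ^t* *m beta k)) => x.
by rewrite /= IH /mulBl addr0 mulmxA.
Qed.

(* The columns of [x] and [b^*] together form a basis, on which both [u] and
   [u b^* b] are determined. *)
Lemma left_kernel_proj b (u : 'M[K]_(p, p + p)) (x : 'M[K]_(p + p, p)) L :
  b *m b ^t* = 1%:M -> L *m x = 1%:M -> b *m x = 0 -> u *m x = 0 ->
  u *m (b ^t* *m b) = u.
Proof.
move=> bb Lx bx ux.
have uG : row_mx x (b ^t*) \in unitmx.
  have : col_mx L b *m row_mx x (b ^t*) \in unitmx.
    by rewrite mul_col_row Lx bx bb unitmxE det_ublock !det1 mulr1 unitr1.
  by rewrite unitmx_mul => /andP[].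
rewrite -[LHS](mulmxK uG) -[RHS](mulmxK uG); congr (_ *m _).
by rewrite !mul_mx_row ux -!mulmxA bx bb !mulmx0 mulmx1.
Qed.

(** * Divisibility by powers of z and the telescoping identity *)

Section Vanishing.
Variables (n : nat) (beta : nat -> 'M[K]_(p, p + p)) (a : nat -> 'M[K]_p).
Hypothesis betaP : forall k, (k <= n)%N -> beta k *m (beta k) ^t* = 1%:M.

Definition graph_col k : 'M[K]_(p + p, p) := col_mx (a k) ((k == 0)%N%:R)%:M.
Definition graph_row k : 'M[K]_(p, p + p) := row_mx ((k == 0)%N%:R)%:M (- a k).

Hypothesis xP : exists x : nat -> 'M[K]_(p + p, p),
  mulBs beta n.+1 x =1 graph_col.

Let u := mulsB beta graph_row.

Lemma conv_graph k : convmx graph_row graph_col k = 0.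
Proof.
rewrite /convmx /graph_row /graph_col.
under eq_bigr do rewrite mul_row_col mulNmx mul_scalar_mx mul_mx_scalar.
rewrite sumrB big_ord_recl big_ord_recr /= subn0 subnn scale1r.
rewrite !big1 ?addr0 ?add0r ?subrr// => i _; last by rewrite scale0r.
by rewrite subn_eq0 leqNgt ltn_ord scale0r.
Qed.

(** Factors of index above j are absorbed into the column, by downward induction from n. Factor j
    stays explicit, so that the constant term of [mulBl (beta j) x] lies in the range of 1 - b_j^*
    b_j. *)
Lemma mulBs_lower j : (j <= n)%N -> exists x : nat -> 'M[K]_(p + p, p),
  mulBs beta j (mulBl (beta j) x) =1 graph_col.
Proof.
move=> jn; rewrite -(subKn jn); move: (leq_subr j n).
elim: (n - j)%N => [_|d IH dn]; first by rewrite subn0; exact: xP.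
have [x] := IH (ltnW dn); rewrite -{1}(subnSK dn) /= => xE.
by exists (mulBl (beta (n - d)%N) x).
Qed.

(** From j to j + 1 the only new coefficient is that of z^j, equal to u_jj - u_jj b_j^* b_j. The
    coefficient of z^j in e [phi; I] = 0 reduces to u_jj y_0 = 0, where y_0 has a left inverse and
    b_j y_0 = 0, so [left_kernel_proj] applies. *)
Lemma mulsB_vanish j k : (j <= n.+1)%N -> (k < j)%N -> u j k = 0.
Proof.
elim: j k => // j IH k jn kj.
rewrite /u /= -/u /mulBr.
move: kj; rewrite ltnS leq_eqVlt => /predU1P[->|kj]; last first.
  rewrite (IH k) ?(ltnW jn)// mul0mx add0r; case: k kj => // k kj.
  by rewrite (IH k) ?mul0mx ?(ltnW jn)// ltnW.
have -> : (if j is k'.+1 then u j k' *m ((beta j)^t* *m beta j) else 0) = 0.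
  by case: j IH jn => // j IH jn; rewrite IH ?mul0mx// ltnW.
rewrite addr0 mulmxBr mulmx1.
have [x xE] := mulBs_lower (jn : (j <= n)%N).
set y := mulBl (beta j) x in xE.
have [A AE] := mulBs_at0 beta p j.
have := AE y; rewrite xE /graph_col => /(congr1 dsubmx).
rewrite col_mxKd -[A in A *m _]vsubmxK mul_col_mx col_mxKd => /esym LE.
apply/eqP; rewrite subr_eq0 eq_sym; apply/eqP; apply: left_kernel_proj LE _ _.
- exact: betaP.
- by rewrite /y /mulBl addr0 !mulmxA mulmxBr mulmx1 mulmxA betaP// mul1mx subrr mul0mx.
have : convmx (u j) y j = 0.
  rewrite /u convmx_mulsB -[RHS](conv_graph j).
  by apply: eq_bigr => i _; rewrite xE.
rewrite /convmx big_ord_recr /= subnn big1 ?add0r// => i _.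
by rewrite IH ?mul0mx// ltnW.
Qed.

Lemma mulsB_diag_proj j : (j <= n)%N ->
  u j j *m ((beta j)^t* *m beta j) = u j j.
Proof.
move=> jn; have := @mulsB_vanish j.+1 j jn (leqnn _).
rewrite /u /= -/u /mulBr.
have -> : (if j is k'.+1 then u j k' *m ((beta j)^t* *m beta j) else 0) = 0.
  by case: j jn => // j jn; rewrite mulsB_vanish ?mul0mx// ltnW.
by rewrite addr0 mulmxBr mulmx1 => /eqP; rewrite subr_eq0 => /eqP.
Qed.

(** At j = 0 the left block of u_00 b_0^* b_0 = u_00 exhibits an inverse. For the step, u_jj b_j^*
    equals u_{j+1,j+1} b_j^*, which is the product of u_{j+1,j+1} b_{j+1}^* and b_{j+1} b_j^*; a
    product of square matrices is invertible only if both factors are. *)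
Lemma mulsB_diag_unit j : (j <= n)%N -> u j j *m (beta j)^t* \in unitmx.
Proof.
elim: j => [|j IH] jn.
  have := mulsB_diag_proj jn; rewrite mulmxA => /(congr1 lsubmx).
  rewrite -[X in _ *m X](hsubmxK) mul_mx_row row_mxKl [in RHS]/u /= row_mxKl.
  by move=> /mulmx1_unit[].
have := IH (ltnW jn).
have -> : u j j *m (beta j)^t* = u j.+1 j.+1 *m (beta j)^t*.
  rewrite [in RHS]/u /= -/u /mulBr mulmxDl -mulmxA mulmxBl mul1mx.
  rewrite -!mulmxA betaP ?(ltnW jn)// mulmx1 subrr mulmx0 add0r.
  by [].
rewrite -(mulsB_diag_proj jn) mulmxA -mulmxA unitmx_mul => /andP[? _].
by rewrite -mulmxA betaP// mulmx1.
Qed.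

(** Coefficient of z^k in the telescoped identity divided by 1 - z; the end row contributes nothing
    because k <= m. *)
Lemma mulsB_telescope m j k : (m <= n)%N -> (k <= m)%N -> (j <= m.+1)%N ->
  \sum_(j <= l < m.+1) u l k *m ((beta l)^t* *m beta l)
  = \sum_(i < k.+1) u j i.
Proof.
move=> mn + jm; have dec k' l : u l k' - u l.+1 k' =
    u l k' *m ((beta l)^t* *m beta l)
    - (if k' is k''.+1 then u l k'' *m ((beta l)^t* *m beta l) else 0).
  rewrite [in u l.+1 k']/u /= -/u /mulBr mulmxBr mulmx1.
  by rewrite opprD addrA opprB addrCA subrr addr0.
have tele k' : (k' <= m)%N ->
    \sum_(j <= l < m.+1) (u l k' - u l.+1 k') = u j k'.
  move=> km; rewrite (@telescope_sumr_eq _ j m.+1 (fun l => - u l k'))//.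
    by rewrite opprK (@mulsB_vanish m.+1)// oppr0 add0r.
  by move=> l _; rewrite opprK addrC.
elim: k => [|k IH] km.
  rewrite big_ord1 -(tele 0%N)//; apply: eq_bigr => l _.
  by rewrite dec subr0.
rewrite big_ord_recr /= -(tele k.+1)// -IH ?(ltnW km)// -big_split /=.
by apply: eq_bigr => l _; rewrite dec addrC subrK.
Qed.

(** * The matrices V, A' and S at level m *)

Section Level.
Variable m : nat.
Hypothesis mn : (m <= n)%N.

Let v k j : 'M[K]_p := u j k *m (beta j)^t*.

Definition similarity : 'M[K]_(\sum_(i < m.+1) p) :=
  \mxblock_(k < m.+1, j < m.+1) v k j.

(** This is A'. Its strictly lower part is that of i B B^*, and its diagonal blocks i/2 are half of
    those of i B B^*, since b_k b_k^* = 1. *)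
Definition model : 'M[K]_(\sum_(i < m.+1) p) :=
  \mxblock_(k < m.+1, j < m.+1)
    (if k == j then ('i / 2)%:M
     else if (j < k)%N then 'i *: (beta k *m (beta j)^t*) else 0).

Lemma v_upper k j : (j <= n)%N -> (k < j)%N -> v k j = 0.
Proof. by move=> jn kj; rewrite /v mulsB_vanish ?mul0mx// leqW. Qed.

Lemma Pimx_graph : Pimx m a = \mxcol_(k < m.+1) \sum_(i < k.+1) graph_row i.
Proof.
have sumE k : \sum_(i < k.+1) graph_row i
    = row_mx 1%:M (- \sum_(0 <= i < k.+1) a i).
  rewrite -[LHS]hsubmxK !linear_sum /= /graph_row.
  under eq_bigr do rewrite row_mxKl.
  under [X in row_mx _ X]eq_bigr do rewrite row_mxKr.
  congr (row_mx _ _); last by rewrite big_mkord.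
  rewrite big_ord_recl big1 ?addr0// => i _.
  by apply/matrixP => r c; rewrite !mxE mul0rn.
under eq_mxcol do rewrite sumE.
by apply/matrixP => r c; rewrite !mxE; case: fintype.split => c'; rewrite !mxE.
Qed.

Lemma similarity_Bmx : similarity *m Bmx m beta = Pimx m a.
Proof.
rewrite /similarity /Bmx mul_mxblock_mxrow Pimx_graph; apply: eq_mxcol => k.
have km : (k <= m)%N by rewrite -ltnS.
rewrite -(@mulsB_telescope m 0 k)// big_mkord.
by apply: eq_bigr => j _; rewrite /v mulmxA.
Qed.

(** As M_j b_j^* = z b_j^*, row j + 1 multiplied by b_j^* is z times column j of V. The telescoped
    sum started at j + 1 therefore produces the partial sums of that column, shifted by one. *)
Lemma v_tail k j : (k <= m)%N -> (j <= m)%N ->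
  \sum_(j.+1 <= l < m.+1) v k l *m (beta l *m (beta j)^t*) = \sum_(i < k) v i j.
Proof.
move=> km jm; have jn := leq_trans jm mn.
under eq_bigr do rewrite /v mulmxA -(mulmxA (u _ _)).
rewrite -mulmx_suml mulsB_telescope// mulmx_suml.
have stepE i : u j.+1 i *m (beta j)^t* = if i is i'.+1 then v i' j else 0.
  rewrite [in LHS]/u /= -/u /mulBr mulmxDl -mulmxA mulmxBl mul1mx -!mulmxA.
  rewrite betaP// mulmx1 subrr mulmx0 add0r; case: i => [|i]; first by rewrite mul0mx.
  by rewrite -!mulmxA betaP// mulmx1.
under eq_bigr do rewrite stepE.
by rewrite big_ord_recl add0r.
Qed.

Lemma Amx_similarity : Amx K m p *m similarity = similarity *m model.
Proof.
rewrite /Amx /similarity /model !mul_mxblock; apply/eq_mxblock => k j.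
have km : (k <= m)%N by rewrite -ltnS.
have jm : (j <= m)%N by rewrite -ltnS.
have -> : \sum_(l < m.+1) (if k == l then 'i / 2 else
    if (l < k)%N then 'i else 0)%:M *m v l j
    = ('i / 2) *: v k j + 'i *: \sum_(l < m.+1 | (l < k)%N) v l j.
  rewrite (bigD1 k)//= eqxx mul_scalar_mx scaler_sumr; congr (_ + _).
  rewrite big_mkcond [RHS]big_mkcond /=; apply: eq_bigr => l _.
  rewrite mul_scalar_mx eq_sym; case: eqVneq => [->|_] /=; first by rewrite ltnn.
  by case: ltnP; rewrite ?scale0r.
have -> : \sum_(l < m.+1) v k l *m (if l == j then ('i / 2)%:M else
    if (j < l)%N then 'i *: (beta l *m (beta j)^t*) else 0)
    = ('i / 2) *: v k j
      + 'i *: \sum_(l < m.+1 | (j < l)%N) v k l *m (beta l *m (beta j)^t*).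
  rewrite (bigD1 j)//= eqxx mul_mx_scalar scaler_sumr; congr (_ + _).
  rewrite big_mkcond [RHS]big_mkcond /=; apply: eq_bigr => l _.
  case: eqVneq => [->|_] /=; first by rewrite ltnn.
  by case: ltnP; rewrite ?mulmx0// -scalemxAr.
congr (_ + _ *: _).
rewrite -(big_ord_widen _ (fun l => v l j)) ?(leqW km)//.
rewrite -(v_tail km jm) (big_nat_widenl j.+1 0)// big_mkord.
by apply: eq_bigl.
Qed.

Lemma model_adj : model - model ^t* = 'i *: (Bmx m beta *m (Bmx m beta)^t*).
Proof.
rewrite /model /Bmx tr_mxblock tr_mxcol.
have scab (F : 'I_m.+1 -> 'I_m.+1 -> 'M[K]_p) (c : K) :
    c *: (\mxblock_(k < m.+1, j < m.+1) F k j)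
    = \mxblock_(k < m.+1, j < m.+1) (c *: F k j).
  by apply/matrixP => r s; rewrite !mxE.
rewrite map_mxblock map_mxrow mul_mxcol_mxrow -mxblockB scab; apply/eq_mxblock => k j.
have kn : (k <= n)%N by rewrite (leq_trans _ mn)// -ltnS.
have conjE : (beta j *m (beta k)^t*)^t* = beta k *m (beta j)^t*.
  by rewrite adjmx_mul trmxCK.
rewrite (eq_sym j k); case: eqVneq => [<-|kj].
  rewrite betaP// tr_scalar_mx map_scalar_mx /= conj_half_i -raddfB /= opprK.
  by rewrite -splitr scalemx1.
case: (ltngtP j k) => [jk|jk|jk].
- by rewrite trmx0 map_mx0 subr0.
- by rewrite linearZ /= map_mxZ /= conjCi conjE sub0r scaleNr opprK.
- by rewrite (ord_inj jk) eqxx in kj.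
Qed.

(** Forward substitution, with the diagonal blocks inverted by [mulsB_diag_unit]. *)
Lemma similarity_unit : similarity \in unitmx.
Proof.
rewrite -unitmx_tr -row_free_unit; apply: inj_row_free => w wV.
have {wV} : similarity *m w^T = 0 by rewrite -[similarity]trmxK -trmx_mul wV trmx0.
rewrite /similarity -[w^T]submxcolK mul_mxblock_mxrow => /mxcolP vw.
suff w0 (k : 'I_m.+1) : submxcol w^T k = 0.
  rewrite -[w]trmxK -[w^T]submxcolK; apply/eqP; rewrite trmx_eq0; apply/eqP.
  by apply/mxcolP => k; rewrite mxcolK w0 submxcol0.
have [l] := ubnP (nat_of_ord k); elim: l k => // l IH k kl.
have kn : (k <= n)%N by rewrite (leq_trans _ mn)// -ltnS.
have := vw k; rewrite mxcolK submxcol0 (bigD1 k)//= [X in _ + X]big1 => [|j jk].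
  rewrite addr0 => vk0; rewrite -[LHS](mulKmx (mulsB_diag_unit kn)).
  by rewrite [X in _ *m X]vk0 mulmx0.
move: jk; rewrite neq_ltn => /orP[jk|kj].
  by rewrite (IH j) ?mulmx0// (leq_trans jk).
by rewrite v_upper ?mul0mx// (leq_trans _ mn)// -ltnS.
Qed.

Lemma recovery_level : exists S : 'M[K]_(\sum_(i < m.+1) p),
  [/\ S_identity a S, forall S', S_identity a S' -> S' = S,
      S \in unitmx, posdefmx S
    & (Pimx m a)^t* *m invmx S *m Pimx m a = (Bmx m beta)^t* *m Bmx m beta].
Proof.
have Vu := similarity_unit.
have VPi : invmx similarity *m Pimx m a = Bmx m beta.
  by rewrite -similarity_Bmx mulKmx.
have Vtu : similarity^t* \in unitmx by rewrite map_unitmx unitmx_tr.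
have Sid : S_identity a (similarity *m similarity^t*).
  rewrite /S_identity -similarity_Bmx mulmxA Amx_similarity -!mulmxA -adjmx_mul.
  rewrite Amx_similarity !adjmx_mul !mulmxA -mulmxBl -mulmxBr model_adj.
  by rewrite -scalemxAr -scalemxAl !mulmxA.
exists (similarity *m similarity^t*); split.
- exact: Sid.
- move=> S' S'id; apply/eqP; rewrite -subr_eq0; apply/eqP.
  apply: Sylvester_Amx_inj.
  have := S'id; rewrite /S_identity -[RHS]Sid => /eqP; rewrite -subr_eq0 => /eqP <-.
  by rewrite mulmxBr mulmxBl !opprD !opprK addrACA.
- by rewrite unitmx_mul Vu Vtu.
- split.
    by apply/is_hermitianmxP; rewrite expr0 scale1r adjmx_mul trmxCK.
  move=> x x0; have y0 : similarity^t* *m x != 0.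
    by apply: contra x0 => /eqP Vx0; rewrite -(mulKmx Vtu x) Vx0 mulmx0.
  rewrite mulmxA -mulmxA -[X in (X *m _)](trmxCK) adjmx_mul trmxCK.
  set y := similarity^t* *m x in y0 *.
  have -> : (y^t* *m y) 0 0 = \sum_i `|y i 0| ^+ 2.
    by rewrite mxE; apply: eq_bigr => i _; rewrite !mxE mulrC -normCK.
  rewrite lt0r sumr_ge0 ?andbT => [|i _]; last by rewrite exprn_ge0.
  apply: contra y0 => /eqP.
  move/(psumr_eq0P (fun i _ => exprn_ge0 2 (normr_ge0 (y i 0)))) => y0.
  apply/eqP/matrixP => i j; rewrite ord1 [RHS]mxE; apply/eqP.
  by rewrite -normr_eq0 -sqrf_eq0 y0.
- have -> : invmx (similarity *m similarity^t*)
      = (invmx similarity)^t* *m invmx similarity.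
    apply: (can_inj (mulmxK (_ : similarity *m similarity^t* \in unitmx))).
      by rewrite unitmx_mul Vu.
    rewrite mulVmx ?unitmx_mul ?Vu// -!mulmxA (mulmxA (invmx _)) mulVmx// mul1mx.
    by rewrite -adjmx_mul mulmxV// trmx1 map_mx1.
  by rewrite mulmxA -mulmxA VPi -adjmx_mul VPi.
Qed.

End Level.
End Vanishing.
End BlaschkeFactors.

(** * Germs of analytic functions without limits *)

Section WienerNorm.
Variable K : numFieldType.
Implicit Types (P Q : {poly K}) (r s : K).

(** The norm of the Wiener algebra of the disk of radius r: it is submultiplicative and dominates
    |P(z)| for |z| <= r. *)
Definition wnorm P r := \sum_(i < size P) `|P`_i| * r ^+ i.

Lemma wnorm_widen N P r : (size P <= N)%N ->
  wnorm P r = \sum_(i < N) `|P`_i| * r ^+ i.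
Proof.
move=> PN; rewrite /wnorm (big_ord_widen _ (fun i => `|P`_i| * r ^+ i) PN).
rewrite big_mkcond; apply: eq_bigr => i _; case: ltnP => // Pi.
by rewrite nth_default ?normr0 ?mul0r.
Qed.

Lemma wnorm_ge0 P r : 0 <= r -> 0 <= wnorm P r.
Proof. by move=> r0; apply: sumr_ge0 => i _; rewrite mulr_ge0 ?exprn_ge0. Qed.

Lemma wnormD P Q r : 0 <= r -> wnorm (P + Q) r <= wnorm P r + wnorm Q r.
Proof.
move=> r0; pose N := maxn (size P) (size Q).
rewrite (@wnorm_widen N (P + Q)) ?size_polyD//.
rewrite (@wnorm_widen N P) ?leq_maxl// (@wnorm_widen N Q) ?leq_maxr// -big_split /=.
apply: ler_sum => i _; rewrite coefD -mulrDl ler_wpM2r ?exprn_ge0//.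
exact: ler_normD.
Qed.

Lemma wnorm_cons P c r : wnorm (P * 'X + c%:P) r = `|c| + r * wnorm P r.
Proof.
rewrite (@wnorm_widen (size P).+1); last first.
  by rewrite size_MXaddC; case: ifP.
rewrite big_ord_recl /= expr0 mulr1 coefD coefMX coefC add0r /=; congr (_ + _).
rewrite /wnorm mulr_sumr; apply: eq_bigr => i _.
by rewrite /bump /= coefD coefMX coefC /= addr0 exprS mulrCA.
Qed.

Lemma wnorm0 r : wnorm 0 r = 0.
Proof. by rewrite /wnorm size_poly0 big_ord0. Qed.

Lemma wnormC c r : wnorm c%:P r = `|c|.
Proof. by have := wnorm_cons 0 c r; rewrite mul0r add0r wnorm0 mulr0 addr0. Qed.

Lemma wnormZ c P r : wnorm (c *: P) r = `|c| * wnorm P r.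
Proof.
rewrite (@wnorm_widen (size P)) ?size_scale_leq// mulr_sumr.
by apply: eq_bigr => i _; rewrite coefZ normrM mulrA.
Qed.

Lemma wnormM P Q r : 0 <= r -> wnorm (P * Q) r <= wnorm P r * wnorm Q r.
Proof.
move=> r0; elim/poly_ind: P => [|P c IH]; first by rewrite mul0r wnorm0 mul0r.
rewrite wnorm_cons mulrDl mul_polyC (le_trans (wnormD _ _ r0))//.
rewrite wnormZ mulrAC -[P * Q * 'X]addr0 -polyC0 wnorm_cons normr0 add0r.
by rewrite addrC mulrDl lerD2l -mulrA ler_wpM2l.
Qed.

(** Induction along Horner's scheme, submultiplicativity replacing Q by its norm. *)
Lemma wnorm_comp P Q r : 0 <= r -> wnorm (P \Po Q) r <= wnorm P (wnorm Q r).
Proof.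
move=> r0; elim/poly_ind: P => [|P c IH]; first by rewrite comp_poly0 !wnorm0.
rewrite comp_polyD comp_polyM comp_polyX comp_polyC wnorm_cons addrC.
rewrite (le_trans (wnormD _ _ r0))// wnormC lerD2l (le_trans (wnormM _ _ r0))//.
by rewrite mulrC ler_wpM2l ?wnorm_ge0.
Qed.

Lemma le_wnorm P r s : 0 <= r -> r <= s -> wnorm P r <= wnorm P s.
Proof.
move=> r0 rs; apply: ler_sum => i _; rewrite ler_wpM2l// lerXn2r//.
by rewrite nnegrE (le_trans r0).
Qed.

(** Without a constant term only powers t^i with i >= 1 occur, and t^i <= t. *)
Lemma wnorm_shrink P t r : 0 <= t <= 1 -> 0 <= r -> P.[0] = 0 ->
  wnorm P (t * r) <= t * wnorm P r.
Proof.
move=> /andP[t0 t1] r0 P0; rewrite /wnorm mulr_sumr; apply: ler_sum => i _.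
have [->|i0] := posnP i; first by rewrite -horner_coef0 P0 normr0 !mul0r mulr0.
rewrite exprMn mulrCA ler_wpM2r ?mulr_ge0 ?exprn_ge0//.
by rewrite -[leRHS]expr1 ler_wiXn2l.
Qed.

Lemma norm_horner_le P z : `|P.[z]| <= wnorm P `|z|.
Proof.
rewrite horner_coef (le_trans (ler_norm_sum _ _ _))// ler_sum// => i _.
by rewrite normrM normrX.
Qed.

(** Halving the radius pays for the derivative: the difference of the powers of exponent k + 1 costs
    (k + 1) (s/2)^k, and k + 1 <= 2^k. *)
Lemma horner_lipschitz P s x y : 0 < s -> `|x| <= s / 2 -> `|y| <= s / 2 ->
  `|P.[x] - P.[y]| <= wnorm P s / s * `|x - y|.
Proof.
move=> s0 xs ys; rewrite !horner_coef -sumrB /wnorm mulr_suml mulr_suml.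
rewrite (le_trans (ler_norm_sum _ _ _))// ler_sum// => i _.
rewrite -mulrBr normrM -!mulrA ler_wpM2l//.
case: (i : nat) => [|k].
  by rewrite !expr0 subrr normr0 mul1r mulr_ge0// invr_ge0 ltW.
rewrite subrXX normrM mulrC mulrA ler_wpM2r//.
rewrite exprSr mulfK ?gt_eqF// (le_trans (ler_norm_sum _ _ _))//.
apply: (@le_trans _ _ (\sum_(j < k.+1) (s / 2) ^+ k)).
  apply: ler_sum => j _; rewrite normrM !normrX /=.
  have jk : (j <= k)%N by rewrite -ltnS.
  have s20 : 0 <= s / 2 by rewrite divr_ge0// ltW.
  rewrite -[in leRHS](subnK jk) exprD ler_pM ?exprn_ge0// lerXn2r// nnegrE//.
rewrite sumr_const card_ord -[leLHS]mulr_natr exprMn exprVn -mulrA ger_pMr ?exprn_gt0//.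
rewrite mulrC ler_pdivrMr ?exprn_gt0// mul1r -natrX ler_nat.
exact: ltn_expl.
Qed.

Lemma horner_tail P m r z : 0 < r -> `|z| <= r ->
  `|P.[z] - (take_poly m P).[z]| <= wnorm P r * (`|z| / r) ^+ m.
Proof.
move=> r0 zr; rewrite -{1}[P](poly_take_drop m) hornerD hornerM hornerXn.
rewrite addrAC subrr add0r normrM normrX expr_div_n.
rewrite [leRHS]mulrCA mulrC ler_wpM2l ?exprn_ge0//.
rewrite ler_pdivlMr ?exprn_gt0//.
have Dr := le_trans (norm_horner_le (drop_poly m P) z) (le_wnorm _ (normr_ge0 z) zr).
apply: (@le_trans _ _ (wnorm (drop_poly m P) r * r ^+ m)).
  by rewrite ler_wpM2r// exprn_ge0// ltW.
rewrite /wnorm size_drop_poly -!(big_mkord predT (fun i => `|_`_i| * r ^+ i)).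
have [Pm|mP] := leqP (size P) m.
  rewrite (eqP (Pm : size P - m == 0)%N) big_nil mul0r sumr_ge0// => i _.
  by rewrite mulr_ge0// exprn_ge0// ltW.
rewrite [leRHS](big_cat_nat (n := m)) ?(ltnW mP)//=.
rewrite -[X in _ + \big[_/_]_(X <= _ < _) _]add0n big_addn mulr_suml.
rewrite -[leLHS]add0r; apply: lerD.
  by apply: sumr_ge0 => i _; rewrite mulr_ge0// exprn_ge0// ltW.
by apply: ler_sum => i _; rewrite coef_drop_poly exprD mulrA.
Qed.

End WienerNorm.

(* A series-free description of the functions given near 0 by an absolutely
   convergent power series: the polynomials [P] need not be the Taylor
   polynomials, which makes the stability properties immediate. *)
Section WienerClass.
Variable K : numFieldType.
Implicit Types (f g h : K -> K) (r M : K).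

Definition approximable f r M := forall m, exists2 P : {poly K},
  wnorm P r <= M &
  forall z, `|z| <= r -> `|f z - P.[z]| <= M * (`|z| / r) ^+ m.

Definition analytic0 f := exists r M, 0 < r /\ approximable f r M.

Lemma approximable_ge0 f r M : 0 < r -> approximable f r M -> 0 <= M.
Proof.
move=> r0 /(_ 0%N)[P + _]; apply: le_trans.
by apply: wnorm_ge0; exact: ltW.
Qed.

(** The order of K is partial, but positive elements are real, hence comparable. *)
Lemma pos_lower_bound (x y : K) : 0 < x -> 0 < y ->
  exists2 z, 0 < z & z <= x /\ z <= y.
Proof.
move=> x0 y0; have [xy|yx] := real_leP (gtr0_real x0) (gtr0_real y0).
  by exists x.
by exists y => //; split => //; exact: ltW.
Qed.

Lemma approximable_shrink f r M s : 0 < s -> s <= r ->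
  approximable f r M -> approximable f s M.
Proof.
move=> s0 sr fa m; have r0 := lt_le_trans s0 sr; have M0 := approximable_ge0 r0 fa.
have [P PM fP] := fa m; exists P.
  by rewrite (le_trans _ PM)// le_wnorm// ltW.
move=> z zs; rewrite (le_trans (fP z (le_trans zs sr)))// ler_wpM2l//.
by rewrite lerXn2r ?nnegrE ?divr_ge0 ?(ltW r0) ?(ltW s0)// ler_wpM2l// lef_pV2.
Qed.

Lemma approximable_bound f r M z : 0 < r -> approximable f r M ->
  `|z| <= r -> `|f z| <= 2 * M.
Proof.
move=> r0 /(_ 0%N)[P PM fP] zr; rewrite -(subrK P.[z] (f z)) mulr2n mulrDl mul1r.
rewrite (le_trans (ler_normD _ _))// lerD//.
  by rewrite (le_trans (fP z zr))// expr0 mulr1.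
by rewrite (le_trans (norm_horner_le _ _))// (le_trans _ PM)// le_wnorm.
Qed.

Lemma analytic0_pair f g : analytic0 f -> analytic0 g ->
  exists r M N, [/\ 0 < r, approximable f r M & approximable g r N].
Proof.
move=> [r [M [r0 fa]]] [s [N [s0 ga]]].
have [t t0 [tr ts]] := pos_lower_bound r0 s0.
by exists t, M, N; split => //; [exact: approximable_shrink fa|exact: approximable_shrink ga].
Qed.

Lemma analytic0_near f g r : 0 < r -> (forall z, `|z| <= r -> f z = g z) ->
  analytic0 f -> analytic0 g.
Proof.
move=> r0 fg [s [M [s0 fa]]]; have [t t0 [tr ts]] := pos_lower_bound r0 s0.
exists t, M; split => // m; have [P PM fP] := approximable_shrink t0 ts fa m.
by exists P => // z zt; rewrite -fg ?fP// (le_trans zt).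
Qed.

Lemma eq_analytic0 f g : f =1 g -> analytic0 f -> analytic0 g.
Proof. by move=> fg; apply: (@analytic0_near f g 1) => // z _. Qed.

Lemma analytic0_poly (P : {poly K}) : analytic0 (horner P).
Proof.
exists 1, (wnorm P 1); split => // m; exists P => // z z1.
by rewrite subrr normr0 mulr_ge0 ?exprn_ge0 ?divr_ge0 ?wnorm_ge0.
Qed.

Lemma analytic0_cst c : analytic0 (fun=> c).
Proof. by apply: eq_analytic0 (analytic0_poly c%:P) => z; rewrite hornerC. Qed.

Lemma analytic0_id : analytic0 id.
Proof. by apply: eq_analytic0 (analytic0_poly 'X) => z; rewrite hornerX. Qed.

Lemma analytic0D f g : analytic0 f -> analytic0 g -> analytic0 (fun z => f z + g z).
Proof.
move=> fa ga; have [r [M [N [r0 {}fa {}ga]]]] := analytic0_pair fa ga.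
exists r, (M + N); split => // m.
have [P PM fP] := fa m; have [Q QN gQ] := ga m; exists (P + Q).
  by rewrite (le_trans (wnormD _ _ (ltW r0)))// lerD.
move=> z zr; rewrite hornerD opprD addrACA mulrDl.
by rewrite (le_trans (ler_normD _ _))// lerD ?fP ?gQ.
Qed.

Lemma analytic0M f g : analytic0 f -> analytic0 g -> analytic0 (fun z => f z * g z).
Proof.
move=> fa ga; have [r [M [N [r0 {}fa {}ga]]]] := analytic0_pair fa ga.
have M0 := approximable_ge0 r0 fa; have N0 := approximable_ge0 r0 ga.
(* 3 = 2 + 1: in f (g - Q) + (f - P) Q, |f| is at most 2 M and |Q| at most N. *)
exists r, (3 * (M * N)); split => // m.
have [P PM fP] := fa m; have [Q QN gQ] := ga m; exists (P * Q).
  rewrite (le_trans (wnormM _ _ (ltW r0)))//.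
  apply: (@le_trans _ _ (M * N)); first by rewrite ler_pM ?wnorm_ge0 ?(ltW r0).
  by rewrite ler_peMl ?mulr_ge0// ler1n.
move=> z zr; rewrite hornerM.
have -> : f z * g z - P.[z] * Q.[z] = f z * (g z - Q.[z]) + (f z - P.[z]) * Q.[z].
  by rewrite mulrBr mulrBl addrA subrK.
set t := (`|z| / r) ^+ m.
have -> : 3 * (M * N) * t = (2 * M) * (N * t) + (M * t) * N by ring.
rewrite (le_trans (ler_normD _ _))// !normrM lerD// ler_pM//.
- exact: approximable_bound fa zr.
- exact: gQ.
- exact: fP.
- by rewrite (le_trans (norm_horner_le _ _))// (le_trans _ QN)// le_wnorm.
Qed.

Lemma analytic0_sum (I : Type) (s : seq I) (p : pred I) (F : I -> K -> K) :
  (forall i, analytic0 (F i)) -> analytic0 (fun z => \sum_(i <- s | p i) F i z).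
Proof.
move=> Fa; elim: s => [|i s IH].
  by apply: eq_analytic0 (analytic0_cst 0) => z; rewrite big_nil.
case: (boolP (p i)) => pi; last first.
  by apply: eq_analytic0 IH => z; rewrite big_cons (negPf pi).
by apply: eq_analytic0 (analytic0D (Fa i) IH) => z; rewrite big_cons pi.
Qed.

Lemma analytic0_prod (I : Type) (s : seq I) (p : pred I) (F : I -> K -> K) :
  (forall i, analytic0 (F i)) -> analytic0 (fun z => \prod_(i <- s | p i) F i z).
Proof.
move=> Fa; elim: s => [|i s IH].
  by apply: eq_analytic0 (analytic0_cst 1) => z; rewrite big_nil.
case: (boolP (p i)) => pi; last first.
  by apply: eq_analytic0 IH => z; rewrite big_cons (negPf pi).
by apply: eq_analytic0 (analytic0M (Fa i) IH) => z; rewrite big_cons pi.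
Qed.

(** With P approximating g and Q approximating h, the error of P(Q) splits into g - P evaluated at
    h, and P(h) - P(Q), which is controlled by [horner_lipschitz]. *)
Lemma analytic0_comp g h : analytic0 g -> analytic0 h -> h 0 = 0 ->
  analytic0 (g \o h).
Proof.
move=> [s [G [s0 ga]]] [r0 [H [r00 ha]]] h0.
have G0 := approximable_ge0 s0 ga; have H0 := approximable_ge0 r00 ha.
(* The radius is shrunk by t so that 4 t H <= s. Then |h| <= 2 t H q <= (s/2) q with q = |z|/r, and
   h and Q stay in the disk where P is Lipschitz. *)
pose t := s / (s + 4 * H + 1).
have d0 : 0 < s + 4 * H + 1 by rewrite ltr_wpDl// addr_ge0 ?mulr_ge0// ltW.
have t0 : 0 < t by rewrite divr_gt0.
have t1 : t <= 1 by rewrite ler_pdivrMr// mul1r -addrA lerDl addr_ge0 ?mulr_ge0.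
have tH : 4 * (t * H) <= s.
  have -> : 4 * (t * H) = s * ((4 * H) / (s + 4 * H + 1)) by rewrite /t; ring.
  rewrite ler_piMr ?(ltW s0)// ler_pdivrMr// mul1r -addrA addrCA lerDl.
  by rewrite addr_ge0// ltW.
have t01 : 0 <= t <= 1 by rewrite ltW.
pose r := t * r0; have rr0 : r <= r0 by rewrite ger_pMl.
have r_gt0 : 0 < r by rewrite mulr_gt0.
exists r, (G + G * H / s); split => // m.
(* Order m + 1 for h, so that Q vanishes at 0 even when m = 0. *)
have [P PG gP] := ga m; have [Q QH hQ] := ha m.+1.
have Q0 : Q.[0] = 0.
  apply/eqP; have := hQ 0; rewrite normr0 mul0r expr0n mulr0 h0 sub0r normrN.
  by move=> /(_ (ltW r00)); rewrite normr_le0.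
have Qr : wnorm Q r <= t * H.
  by rewrite (le_trans (wnorm_shrink t01 (ltW r00) Q0))// ler_wpM2l// ltW.
exists (P \Po Q).
  rewrite (le_trans (wnorm_comp _ _ (ltW r_gt0)))//.
  rewrite (@le_trans _ _ G) ?lerDl ?divr_ge0 ?mulr_ge0 ?(ltW s0)//.
  rewrite (le_trans _ PG)// le_wnorm ?wnorm_ge0 ?(ltW r_gt0)//.
  by rewrite (le_trans Qr)// (le_trans _ tH)// ler_peMl ?ler1n// mulr_ge0// ltW.
move=> z zr; set q := `|z| / r.
have q01 : 0 <= q <= 1 by rewrite divr_ge0 ?(ltW r_gt0)//= ler_pdivrMr// mul1r.
have [q0 q1] := andP q01.
have zr0 : `|z| / r0 = t * q.
  by rewrite /q /r; field; rewrite !gt_eqF.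
have Qz : `|Q.[z]| <= q * (t * H).
  rewrite (le_trans (norm_horner_le _ _))//.
  have -> : `|z| = q * r by rewrite /q divfK ?gt_eqF.
  by rewrite (le_trans (wnorm_shrink q01 (ltW r_gt0) Q0))// ler_wpM2l.
have hQz : `|h z - Q.[z]| <= H * (t * q) ^+ m.+1.
  by rewrite -zr0 hQ// (le_trans zr).
have tq01 : 0 <= t * q <= 1 by rewrite mulr_ge0 ?(ltW t0)//= mulr_ile1// ltW.
have [tq0 tq1] := andP tq01.
have hz : `|h z| <= q * (s / 2).
  rewrite -(subrK Q.[z] (h z)) (le_trans (ler_normD _ _))//.
  apply: (@le_trans _ _ (H * (t * q) + q * (t * H))).
    apply: lerD => //; rewrite (le_trans hQz)// ler_wpM2l// exprS.
    by rewrite ler_piMr// exprn_ile1.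
  have -> : H * (t * q) + q * (t * H) = q * ((4 * (t * H)) / 2) by field.
  by rewrite ler_wpM2l// ler_wpM2r.
have s20 : 0 <= s / 2 by rewrite divr_ge0// ltW.
have s2s : s / 2 <= s by rewrite ler_pdivrMr// ler_peMr ?ler1n// ltW.
have hz2 : `|h z| <= s / 2 by rewrite (le_trans hz)// ler_piMl.
have tH0 : 0 <= t * H by rewrite mulr_ge0// ltW.
have tH2 : t * H <= s / 2.
  by rewrite ler_pdivlMr// (le_trans _ tH)// mulrC ler_wpM2r// ler_nat.
have Qz2 : `|Q.[z]| <= s / 2.
  by rewrite (le_trans Qz)// (le_trans _ tH2)// ler_piMl.
rewrite horner_comp mulrDl /= -(subrK P.[h z] (g (h z))) -addrA.
rewrite (le_trans (ler_normD _ _))// lerD//.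
  rewrite (le_trans (gP _ (le_trans hz2 s2s)))// ler_wpM2l// lerXn2r ?nnegrE//.
    by rewrite divr_ge0// ltW.
  by rewrite ler_pdivrMr// (le_trans hz)// ler_wpM2l.
rewrite (le_trans (horner_lipschitz _ s0 hz2 Qz2))//.
have -> : G * H / s * q ^+ m = G / s * (H * q ^+ m) by ring.
rewrite ler_pM ?divr_ge0 ?wnorm_ge0 ?(ltW s0)//.
  by rewrite ler_wpM2r// invr_ge0 ltW.
rewrite (le_trans hQz)// ler_wpM2l// (@le_trans _ _ ((t * q) ^+ m))//.
  by rewrite exprS ler_piMl// exprn_ge0.
by rewrite lerXn2r ?nnegrE// ler_piMl// ltW.
Qed.

End WienerClass.

(** * Inversion of germs, uniqueness and existence of coefficients *)

Section Expansions.
Variable K : numFieldType.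
Implicit Types (f g h : K -> K) (a b : nat -> K).

Lemma geometric_sum_le (q : K) n : 0 <= q -> q <= 2^-1 -> \sum_(i < n) q ^+ i <= 2.
Proof.
move=> q0 q2; have q1 : 0 < 1 - q.
  by rewrite subr_gt0 (le_lt_trans q2)// invf_lt1// ltr1n.
have -> : \sum_(i < n) q ^+ i = (1 - q ^+ n) / (1 - q).
  rewrite -(opprB q) -(opprB (q ^+ n)) subrX1 -mulNr mulrC mulKf//.
  by rewrite oppr_eq0 subr_eq0 lt_eqF// -subr_gt0.
rewrite ler_pdivrMr// mulrBr mulr1.
apply: (@le_trans _ _ 1); first by rewrite gerBl exprn_ge0.
by rewrite lerBrDr -lerBrDl (_ : 2 - 1 = 1 :> K) ?addrK// mulrC -ler_pdivlMr// mul1r.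
Qed.

Lemma analytic0_geometric : analytic0 (fun w : K => (1 - w)^-1).
Proof.
have half0 : 0 < 2^-1 :> K by rewrite invr_gt0.
exists 2^-1, 2; split => // m; exists (\poly_(i < m) 1).
  rewrite (@wnorm_widen _ m) ?size_poly//.
  rewrite (le_trans _ (geometric_sum_le m (ltW half0) (lexx _)))//.
  by apply: ler_sum => i _; rewrite coef_poly ltn_ord normr1 mul1r.
move=> z z2; have z1 : `|z| < 1 by rewrite (le_lt_trans z2)// invf_lt1// ltr1n.
have nz1 : 1 - z != 0.
  by rewrite subr_eq0; apply: contraTneq z1 => <-; rewrite normr1 ltxx.
have -> : (1 - z)^-1 - (\poly_(i < m) 1).[z] = z ^+ m / (1 - z).
  rewrite horner_poly; under eq_bigr do rewrite mul1r.
  apply: (mulIf nz1); rewrite mulrBl mulVf// divfK//.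
  by rewrite mulrC -(opprB z) mulNr -subrX1 opprK addrC subrK.
rewrite normrM normfV normrX mulrC ler_pM ?invr_ge0 ?exprn_ge0//.
  rewrite -[leRHS]invrK lef_pV2 ?posrE ?normr_gt0//.
  rewrite (le_trans _ (lerB_dist _ _))// normr1 lerBrDr -lerBrDl (le_trans z2)//.
  by rewrite lerBrDl -mulr2n -[leLHS]mulr_natr mulVf// pnatr_eq0.
rewrite lerXn2r ?nnegrE// ?invrK ?mulr_ge0//.
by rewrite ler_peMr// ler1n.
Qed.

Lemma analytic0_small h : analytic0 h -> h 0 = 0 ->
  exists r M, [/\ 0 < r, 0 < M & forall z, `|z| <= r -> `|h z| <= M * `|z|].
Proof.
move=> [r [M [r0 ha]]] h0; have M0 := approximable_ge0 r0 ha.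
exists r, (2 * M / r + 1); split => //.
  by rewrite ltr_wpDl// divr_ge0 ?mulr_ge0// ltW.
move=> z zr; have [P PM hP] := ha 1%N.
have P0 : P.[0] = 0.
  apply/eqP; have := hP 0; rewrite normr0 mul0r expr1 mulr0 h0 sub0r normrN.
  by move=> /(_ (ltW r0)); rewrite normr_le0.
have q01 : 0 <= `|z| / r <= 1.
  by rewrite divr_ge0 ?(ltW r0)//= ler_pdivrMr// mul1r.
rewrite mulrDl mul1r ler_wpDr// -(subrK P.[z] (h z)).
rewrite (le_trans (ler_normD _ _))//.
have -> : 2 * M / r * `|z| = M * (`|z| / r) ^+ 1 + `|z| / r * M by ring.
rewrite lerD ?hP// (le_trans (norm_horner_le _ _))//.
have {1}-> : `|z| = `|z| / r * r by rewrite divfK ?gt_eqF.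
rewrite (le_trans (wnorm_shrink q01 (ltW r0) P0))// ler_wpM2l//.
by case/andP: q01.
Qed.

Lemma analytic0_neq0 f : analytic0 f -> f 0 != 0 ->
  exists2 r, 0 < r & forall z, `|z| <= r -> f z != 0.
Proof.
move=> fa f0.
have [r [M [r0 M0 fM]]] := analytic0_small (analytic0D fa (analytic0_cst (- f 0))) (subrr _).
have [s s0 [sr sM]] : exists2 s, 0 < s & s <= r /\ s <= `|f 0| / (2 * M).
  by apply: pos_lower_bound => //; rewrite divr_gt0 ?normr_gt0 ?mulr_gt0.
exists s => // z zs; apply: contraTneq (fM z (le_trans zs sr)) => ->.
rewrite sub0r normrN -real_ltNge ?ger0_real// ?mulr_ge0 ?(ltW M0)//.
rewrite (@le_lt_trans _ _ (M * s)) ?ler_wpM2l ?(ltW M0)//.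
rewrite (@le_lt_trans _ _ (`|f 0| / 2))//.
  have -> : `|f 0| / 2 = M * (`|f 0| / (2 * M)) by field; rewrite gt_eqF.
  by rewrite ler_wpM2l// ltW.
by rewrite ltr_pdivrMr// ltr_pMr ?normr_gt0// ltr1n.
Qed.

(** The geometric series is composed with 1 - f / f(0), which vanishes at 0. *)
Lemma analytic0V f : analytic0 f -> f 0 != 0 -> analytic0 (fun z => (f z)^-1).
Proof.
move=> fa f0; pose h z := 1 - (f 0)^-1 * f z.
have ha : analytic0 h.
  apply: analytic0D; first exact: analytic0_cst.
  apply: eq_analytic0 (analytic0M (analytic0_cst (- (f 0)^-1)) fa) => z.
  by rewrite mulNr.
have h0 : h 0 = 0 by rewrite /h mulVf// subrr.
apply: eq_analytic0 (analytic0M (analytic0_cst (f 0)^-1)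
  (analytic0_comp analytic0_geometric ha h0)) => z.
by rewrite /= /h opprB addrC subrK invfM invrK mulKf.
Qed.

(** Since t ranges over K, it may be taken below both r and x / (2 C), which gives x <= x / 2. *)
Lemma le_small_eq0 (x r C : K) : 0 < r -> 0 <= x ->
  (forall t, 0 < t -> t <= r -> x <= C * t) -> x = 0.
Proof.
move=> r0 x0 xC; apply: contraTeq isT => xn0.
have {xn0}x0 : 0 < x by rewrite lt_neqAle eq_sym xn0.
have C0 : 0 < C.
  have := xC r r0 (lexx _) => xCr.
  by have := lt_le_trans x0 xCr; rewrite pmulr_lgt0.
have [s s0 [sr sC]] : exists2 s, 0 < s & s <= r /\ s <= x / (2 * C).
  by apply: pos_lower_bound; rewrite ?divr_gt0 ?mulr_gt0.
have := le_trans (xC s s0 sr) (ler_wpM2l (ltW C0) sC).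
have -> : C * (x / (2 * C)) = x / 2 by field; rewrite gt_eqF.
by rewrite ler_pdivlMr// ger_pMr// lern1.
Qed.

Lemma small_poly_coef (Q : {poly K}) m r C : 0 < r ->
  (forall z, 0 < `|z| -> `|z| <= r -> `|Q.[z]| <= C * `|z| ^+ m) ->
  forall k, (k < m)%N -> Q`_k = 0.
Proof.
move=> r0; elim: m Q => // m IH Q Qm.
have C0 : 0 <= C.
  have := Qm r; rewrite !(ger0_norm (ltW r0)) => /(_ r0 (lexx _)).
  by move=> /(le_trans (normr_ge0 _)); rewrite pmulr_lge0// exprn_gt0.
elim/poly_ind: Q Qm => [_ k _|D c _ Qm]; first by rewrite coef0.
have c0 : c = 0.
  apply/eqP; rewrite -normr_eq0; apply/eqP.
  apply: (@le_small_eq0 _ r (C * r ^+ m + wnorm D r)) => // t t0 tr.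
  have nt : `|t| = t by rewrite ger0_norm// ltW.
  have -> : c = (D * 'X + c%:P).[t] - D.[t] * t by rewrite !hornerE addrAC subrr add0r.
  rewrite (le_trans (ler_normB _ _))// mulrDl lerD//.
    rewrite (le_trans (Qm t _ _)) ?nt// exprSr mulrA ler_wpM2r ?(ltW t0)//.
    by rewrite ler_wpM2l// lerXn2r ?nnegrE ?(ltW t0) ?(ltW r0).
  rewrite normrM nt ler_wpM2r ?(ltW t0)// (le_trans (norm_horner_le _ _))//.
  by rewrite nt le_wnorm// ltW.
move=> [|k] km; rewrite coefD coefMX coefC /= ?c0 ?addr0//.
apply: IH => // z z0 zr; have := Qm z z0 zr.
by rewrite c0 !hornerE normrM exprSr mulrA ler_pM2r.
Qed.

(** Asymptotic expansion in the sense of Poincare: radius and constant may depend on m. This is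
    stable under the operations below and still determines the coefficients. *)
Definition asymptotic f a := forall m, exists r M, 0 < r /\
  forall z, `|z| <= r -> `|f z - \sum_(k < m) z ^+ k * a k| <= M * `|z| ^+ m.

Lemma asymptotic_near f g a r : 0 < r -> (forall z, `|z| <= r -> f z = g z) ->
  asymptotic f a -> asymptotic g a.
Proof.
move=> r0 fg fa m; have [s [M [s0 fM]]] := fa m.
have [t t0 [tr ts]] := pos_lower_bound r0 s0.
exists t, M; split => // z zt; rewrite -fg ?fM//; exact: le_trans zt _.
Qed.

Lemma asymptoticD f g a b : asymptotic f a -> asymptotic g b ->
  asymptotic (fun z => f z + g z) (fun k => a k + b k).
Proof.
move=> fa gb m; have [r [M [r0 fM]]] := fa m; have [s [N [s0 gN]]] := gb m.
have [t t0 [tr ts]] := pos_lower_bound r0 s0.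
exists t, (M + N); split => // z zt.
under eq_bigr do rewrite mulrDr.
rewrite big_split opprD addrACA mulrDl (le_trans (ler_normD _ _))// lerD//=.
  exact/fM/(le_trans zt).
exact/gN/(le_trans zt).
Qed.

Lemma asymptoticZ c f a : asymptotic f a ->
  asymptotic (fun z => c * f z) (fun k => c * a k).
Proof.
move=> fa m; have [r [M [r0 fM]]] := fa m.
exists r, (`|c| * M); split => // z zr.
under eq_bigr do rewrite mulrCA.
by rewrite -mulr_sumr -mulrBr normrM -mulrA ler_wpM2l ?fM.
Qed.

Lemma asymptotic_shift f a : asymptotic f a ->
  asymptotic (fun z => z * f z) (fun k => if k is k'.+1 then a k' else 0).
Proof.
move=> fa [|m].
  have [r [M [r0 fM]]] := fa 0%N; exists r, (r * M); split => // z zr.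
  have := fM z zr; rewrite !big_ord0 !subr0 !expr0 !mulr1 normrM => fzM.
  by rewrite ler_pM.
have [r [M [r0 fM]]] := fa m; exists r, M; split => // z zr.
rewrite big_ord_recl mulr0 add0r.
under eq_bigr do rewrite exprS -mulrA.
by rewrite -mulr_sumr -mulrBr normrM exprS mulrCA ler_wpM2l ?fM.
Qed.

Lemma asymptotic_cst c : asymptotic (fun=> c) (fun k => (k == 0)%N%:R * c).
Proof.
move=> [|m]; exists 1, `|c|; split => // z _.
  by rewrite big_ord0 subr0 expr0 mulr1.
rewrite big_ord_recl big1 ?addr0 => [|i _]; last by rewrite mul0r mulr0.
by rewrite expr0 !mul1r subrr normr0 mulr_ge0 ?exprn_ge0.
Qed.

Lemma asymptotic_sum (I : Type) (s : seq I) (F : I -> K -> K) (A : I -> nat -> K) :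
  (forall i, asymptotic (F i) (A i)) ->
  asymptotic (fun z => \sum_(i <- s) F i z) (fun k => \sum_(i <- s) A i k).
Proof.
move=> FA; elim: s => [|i s IH].
  move=> m; exists 1, 0; split => // z _; rewrite !big_nil big1 => [|k _].
    by rewrite subrr normr0 mul0r.
  by rewrite big_nil mulr0.
move=> m; have [r [M [r0 H]]] := asymptoticD (FA i) IH m.
exists r, M; split => // z zr; rewrite big_cons.
by under [X in _ - X]eq_bigr do rewrite big_cons; exact: H.
Qed.

Lemma asymptotic_unique f a b : asymptotic f a -> asymptotic f b -> a =1 b.
Proof.
move=> fa fb k; have [r [M [r0 fM]]] := fa k.+1; have [s [N [s0 fN]]] := fb k.+1.
have [t t0 [tr ts]] := pos_lower_bound r0 s0.
have := @small_poly_coef (\poly_(i < k.+1) (a i - b i)) k.+1 t (N + M) t0 _ k (ltnSn k).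
rewrite coef_poly ltnSn => ab; apply/eqP; rewrite -subr_eq0; apply/eqP/ab => z z0 zt.
have -> : (\poly_(i < k.+1) (a i - b i)).[z] =
    (f z - \sum_(i < k.+1) z ^+ i * b i) - (f z - \sum_(i < k.+1) z ^+ i * a i).
  rewrite horner_poly opprB addrC addrA subrK -sumrB.
  by apply: eq_bigr => i _; rewrite mulrC mulrBr.
rewrite (le_trans (ler_normB _ _))// mulrDl lerD//.
  exact/fN/(le_trans zt).
exact/fM/(le_trans zt).
Qed.

(** Unlike in [asymptotic], radius and constant are uniform in m and the error is geometric; this is
    what yields convergence once the powers of 1/2 tend to 0. *)
Definition expansion f a := exists r M, 0 < r /\
  forall m z, `|z| <= r -> `|f z - \sum_(k < m) z ^+ k * a k| <= M * (`|z| / r) ^+ m.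

Lemma expansion_asymptotic f a : expansion f a -> asymptotic f a.
Proof.
move=> [r [M [r0 fM]]] m; exists r, (M / r ^+ m); split => // z zr.
by rewrite (le_trans (fM m z zr))// expr_div_n mulrAC mulrA.
Qed.

(** Two approximants of order at least k + 1 differ by O(z^(k+1)), so their coefficients of z^k
    agree by [small_poly_coef]; the common value is read off [P k.+1]. *)
Lemma analytic0_expansion f : analytic0 f -> exists a, expansion f a.
Proof.
move=> [r [M [r0 fa]]]; have M0 := approximable_ge0 r0 fa.
have exP m : exists P, wnorm P r <= M /\
    forall z, `|z| <= r -> `|f z - P.[z]| <= M * (`|z| / r) ^+ m.
  by have [P] := fa m; exists P.
have [P PM] := choice exP.
exists (fun k => (P k.+1)`_k), r, (2 * M); split => // m z zr.
have -> : \sum_(k < m) z ^+ k * (P k.+1)`_k = (take_poly m (P m)).[z].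
  rewrite /take_poly horner_poly; apply: eq_bigr => k _; rewrite mulrC; congr (_ * _).
  apply/eqP; rewrite -subr_eq0 -coefB; apply/eqP.
  apply: (@small_poly_coef _ k.+1 r (2 * M / r ^+ k.+1)) => // y y0 yr.
  rewrite hornerD hornerN.
  have -> : (P k.+1).[y] - (P m).[y] = (f y - (P m).[y]) - (f y - (P k.+1).[y]).
    by rewrite opprB [RHS]addrC addrA subrK.
  rewrite (le_trans (ler_normB _ _))//.
  have -> : 2 * M / r ^+ k.+1 * `|y| ^+ k.+1
      = M * (`|y| / r) ^+ k.+1 + M * (`|y| / r) ^+ k.+1.
    by rewrite expr_div_n; ring.
  rewrite lerD//; last by case: (PM k.+1) => _; apply.
  rewrite (le_trans (proj2 (PM m) y yr))// ler_wpM2l// ler_wiXn2l ?divr_ge0 ?(ltW r0)//.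
  by rewrite ler_pdivrMr// mul1r.
rewrite -(subrK (P m).[z] (f z)) -addrA (le_trans (ler_normD _ _))//.
rewrite mulr2n mulrDl mul1r mulrDl lerD ?(proj2 (PM m))//.
rewrite (le_trans (horner_tail _ m r0 zr))// ler_wpM2r ?exprn_ge0 ?divr_ge0 ?(ltW r0)//.
by case: (PM m).
Qed.

(** Up to eps, f(z) is a partial sum of length m + n0; its terms beyond m are bounded by a geometric
    sum, uniformly in n0, and eps is then dropped. *)
Lemma convergent_expansion f a rho : 0 < rho ->
  (forall z, `|z| < rho -> forall eps, 0 < eps -> exists N, forall n, (N <= n)%N ->
     `|f z - \sum_(k < n) z ^+ k * a k| < eps) ->
  expansion f a /\ analytic0 f.
Proof.
move=> rho0 fa; pose s := rho / 2.
have s0 : 0 < s by rewrite divr_gt0.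
have s_ge0 := ltW s0.
have srho : `|s| < rho by rewrite ger0_norm// ltr_pdivrMr// ltr_pMr// ltr1n.
have [N Ns] := fa s srho 1 ltr01.
(* Bound for |a_k| s^k: from N on, a term is the difference of two errors below 1; the sum accounts
   for the terms before N. *)
pose C := 2 + \sum_(k < N) `|a k| * s ^+ k.
have sum0 : 0 <= \sum_(k < N) `|a k| * s ^+ k.
  by apply: sumr_ge0 => k _; rewrite mulr_ge0// exprn_ge0.
have C0 : 0 <= C by rewrite addr_ge0.
have aC k : `|a k| <= C / s ^+ k.
  rewrite ler_pdivlMr ?exprn_gt0//; have [kN|Nk] := ltnP k N.
    rewrite /C (bigD1 (Ordinal kN))//= addrCA lerDl addr_ge0// sumr_ge0// => i _.
    by rewrite mulr_ge0// exprn_ge0.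
  rewrite -[leLHS]addr0 lerD//.
  have -> : `|a k| * s ^+ k = `|s ^+ k * a k|.
    by rewrite normrM mulrC ger0_norm// exprn_ge0.
  have -> : s ^+ k * a k = (f s - \sum_(i < k) s ^+ i * a i)
      - (f s - \sum_(i < k.+1) s ^+ i * a i).
    by rewrite big_ord_recr /=; ring.
  rewrite (le_trans (ler_normB _ _))// -[2]/(1 + 1) lerD// ltW// Ns//.
  exact: leqW.
pose r := s / 2; have r0 : 0 < r by rewrite divr_gt0.
have rs : r / s = 2^-1 by rewrite /r mulrAC divff ?mul1r// gt_eqF.
have half0 : 0 <= 2^-1 :> K by rewrite invr_ge0.
have fE m z : `|z| <= r -> `|f z - \sum_(k < m) z ^+ k * a k| <= 2 * C * (`|z| / r) ^+ m.
  move=> zr; apply/ler_addgt0Pr => eps eps0.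
  have zrho : `|z| < rho.
    rewrite (le_lt_trans zr)// (le_lt_trans _ srho)// ger0_norm//.
    by rewrite ler_pdivrMr// ler_peMr// ler1n.
  have [n0 fn] := fa z zrho eps eps0; pose n := (m + n0)%N.
  rewrite -(subrK (\sum_(k < n) z ^+ k * a k) (f z)) -addrA addrC.
  rewrite (le_trans (ler_normD _ _))// lerD//; last by rewrite ltW// fn// leq_addl.
  rewrite big_split_ord /= addrAC subrr add0r (le_trans (ler_norm_sum _ _ _))//.
  set q := `|z| / s; have q0 : 0 <= q by rewrite divr_ge0.
  have q2 : q <= 2^-1 by rewrite -rs ler_wpM2r// invr_ge0.
  apply: (@le_trans _ _ (\sum_(i < n0) C * q ^+ m * q ^+ i)).
    apply: ler_sum => i _; rewrite normrM normrX [leLHS]mulrC -mulrA -exprD expr_div_n.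
    by rewrite [leRHS]mulrCA [leRHS]mulrC ler_wpM2r ?exprn_ge0.
  have Cq0 : 0 <= C * q ^+ m by rewrite mulr_ge0// exprn_ge0.
  rewrite -mulr_sumr mulrC -mulrA ler_pM// ?geometric_sum_le//.
    by apply: sumr_ge0 => i _; rewrite exprn_ge0.
  have qr : q <= `|z| / r.
    by rewrite ler_wpM2l// lef_pV2// ler_pdivrMr// ler_peMr// ler1n.
  by rewrite ler_wpM2l// lerXn2r// nnegrE (le_trans q0).
split; first by exists r, (2 * C).
exists r, (2 * C); split => // m; exists (\poly_(k < m) a k); last first.
  move=> z zr; rewrite horner_poly; under eq_bigr do rewrite mulrC.
  exact: fE.
rewrite (@wnorm_widen _ m) ?size_poly//.
apply: (@le_trans _ _ (\sum_(i < m) C * 2^-1 ^+ i)).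
  apply: ler_sum => i _.
  rewrite coef_poly ltn_ord -rs [in leRHS]expr_div_n [leRHS]mulrCA [leRHS]mulrC.
  by rewrite ler_wpM2r// exprn_ge0// ltW.
by rewrite -mulr_sumr mulrC ler_wpM2r// geometric_sum_le.
Qed.

End Expansions.

(** * Weyl functions as germs at z = 0 *)

Section Bridge.
Local Open Scope classical_set_scope.
Variable K : numClosedFieldType.

Lemma near_radius (P : K -> Prop) (z0 : K) : (\forall z \near z0, P z) ->
  exists2 r, 0 < r & forall w, `|w| < r -> P (z0 + w).
Proof.
move=> /nbhs_ballP[r /= r0 rP]; exists r => // w wr; apply: rP.
by rewrite -ball_normE /= opprD addrA subrr add0r normrN.
Qed.

Lemma radius_near (P : K -> Prop) (z0 r : K) : 0 < r ->
  (forall w, `|w| < r -> P (z0 + w)) -> \forall z \near z0, P z.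
Proof.
move=> r0 rP; apply/nbhs_ballP; exists r => //= z.
by rewrite -ball_normE /= distrC => zr; rewrite -(subrK z0 z) addrC; exact: rP.
Qed.

Variables p q : nat.
Implicit Types (F : K -> 'M[K]_(p, q)) (a : nat -> 'M[K]_(p, q)).

Definition mx_analytic0 F := forall i j, analytic0 (fun z => F z i j).

Definition mx_asymptotic F a :=
  forall i j, asymptotic (fun z => F z i j) (fun k => a k i j).

Lemma series_mxE z a n i j :
  series (fun k => z ^+ k *: a k) n i j = \sum_(k < n) z ^+ k * a k i j.
Proof.
by rewrite /series /= big_mkord summxE; apply: eq_bigr => k _; rewrite mxE.
Qed.

Lemma taylor_expansion_entry F z0 a : taylor_expansion F z0 a -> forall i j,
  expansion (fun w => F (z0 + w) i j) (fun k => a k i j) /\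
  analytic0 (fun w => F (z0 + w) i j).
Proof.
move=> /near_radius[r r0 Fa] i j; apply: (convergent_expansion r0) => w wr eps eps0.
have /cvg_ballP/(_ _ eps0)[N _ FN] := Fa w wr.
exists N => n Nn; have [_ /(_ i j)] := FN n Nn.
rewrite -ball_normE /=.
by rewrite [z0 + w]addrC addrK series_mxE.
Qed.

(** Geometric error bounds give convergence only if the powers of 1/2 tend to 0 in K. This
    Archimedean property is a hypothesis here, supplied for R[i] by [geometric_small]. *)
Lemma expansion_taylor F a :
  (forall M e : K, 0 <= M -> 0 < e ->
    exists N, forall m, (N <= m)%N -> M * 2^-1 ^+ m < e) ->
  (forall i j, expansion (fun z => F z i j) (fun k => a k i j)) ->
  taylor_expansion F 0 a.
Proof.
move=> geomK Fa.
have Fij i j : \forall z \near (0 : K), forall eps : K, 0 < eps ->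
    \forall n \near \oo, `|F z i j - \sum_(k < n) z ^+ k * a k i j| < eps.
  have [r [M [r0 FM]]] := Fa i j.
  have M0 : 0 <= M.
    have := FM 0%N 0; rewrite normr0 mul0r expr0 mulr1 => /(_ (ltW r0)).
    exact: le_trans.
  apply: (@radius_near _ _ (r / 2)); first by rewrite divr_gt0.
  move=> w wr eps eps0; rewrite add0r; have [N NM] := geomK _ _ M0 eps0.
  have q2 : `|w| / r <= 2^-1 by rewrite ler_pdivrMr// mulrC ltW.
  have wler : `|w| <= r.
    by rewrite (le_trans (ltW wr))// ler_pdivrMr// ler_peMr ?ler1n// ltW.
  exists N => // n Nn; rewrite /= (le_lt_trans (FM n w wler))// (le_lt_trans _ (NM n Nn))//.
  by rewrite ler_wpM2l// lerXn2r ?nnegrE ?invr_ge0// divr_ge0// ltW.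
have Fall : \forall z \near (0 : K), forall i j (eps : K), 0 < eps ->
    \forall n \near \oo, `|F z i j - \sum_(k < n) z ^+ k * a k i j| < eps.
  exact: (@filter_forall _ _ _ _ (nbhs_filter (0 : K))
    (fun i => @filter_forall _ _ _ _ (nbhs_filter (0 : K)) (Fij i))).
apply: filterS Fall => z Fz; apply/cvg_ballP => eps eps0.
have Feps : \forall n \near \oo, forall i j,
    `|F z i j - \sum_(k < n) z ^+ k * a k i j| < eps.
  exact: (@filter_forall _ _ _ _ eventually_filter
    (fun i => @filter_forall _ _ _ _ eventually_filter (fun j => Fz i j _ eps0))).
apply: filterS Feps => n Fn; split => // i j; rewrite subr0 series_mxE.
exact: Fn.
Qed.

End Bridge.

(** * The Archimedean property of R[i] *)

Section ComplexSeries.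
Variable R : realType.

Lemma geometric_small (M e : R[i]) : 0 <= M -> 0 < e ->
  exists N, forall m, (N <= m)%N -> M * 2^-1 ^+ m < e.
Proof.
case: M => m0 m1; case: e => e0 e1; rewrite lecE ltcE /=.
move=> /andP[/eqP m10 m00] /andP[/eqP e10 e00].
have [N Ne] : exists N : nat, m0 / e0 < N%:R.
  by exists (Num.bound (m0 / e0)); rewrite archi_boundP// divr_ge0// ltW.
exists N => m Nm; rewrite m10 e10 !complexr0.
have -> : (2^-1 ^+ m : R[i]) = (2^-1 ^+ m)%:C%C.
  by rewrite rmorphXn /= fmorphV rmorph_nat.
rewrite -rmorphM ltcR exprVn ltr_pdivrMr ?exprn_gt0// mulrC -ltr_pdivrMr//.
by rewrite (lt_le_trans Ne)// -natrX ler_nat (leq_trans Nm)// ltnW// ltn_expl.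
Qed.

End ComplexSeries.

(** * Factorization of Weyl functions in the variable z *)

Section WeylFunctions.
Variable K : numClosedFieldType.

Lemma eq_asymptotic (f g : K -> K) a b :
  f =1 g -> a =1 b -> asymptotic f a -> asymptotic g b.
Proof. by move=> /funext -> /funext ->. Qed.

Lemma mx_analytic0_mul m n q (F : K -> 'M[K]_(m, n)) (G : K -> 'M[K]_(n, q)) :
  mx_analytic0 F -> mx_analytic0 G -> mx_analytic0 (fun z => F z *m G z).
Proof.
move=> Fa Ga i j; apply: (@eq_analytic0 _ (fun z => \sum_k F z i k * G z k j)).
  by move=> z; rewrite mxE.
by apply: analytic0_sum => k; apply: analytic0M.
Qed.

Lemma analytic0_det n (F : K -> 'M[K]_n) :
  mx_analytic0 F -> analytic0 (fun z => \det (F z)).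
Proof.
move=> Fa; apply: analytic0_sum => s; apply: analytic0M; first exact: analytic0_cst.
by apply: analytic0_prod => i; exact: Fa.
Qed.

Lemma mx_analytic0_adj n (F : K -> 'M[K]_n) :
  mx_analytic0 F -> mx_analytic0 (fun z => \adj (F z)).
Proof.
move=> Fa i j; apply: (@eq_analytic0 _ (fun z => cofactor (F z) j i)).
  by move=> z; rewrite mxE.
apply: analytic0M; first exact: analytic0_cst.
apply: (analytic0_det (F := fun z => row' j (col' i (F z)))) => k l.
by apply: eq_analytic0 (Fa (lift j k) (lift i l)) => z; rewrite !mxE.
Qed.

Variable p : nat.

(** The Blaschke-Potapov factor with zero at z = 0; [mulBl] and [mulBr] are its action on
    coefficients. *)
Definition blaschke (b : 'M[K]_(p, p + p)) (z : K) : 'M[K]_(p + p) :=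
  1%:M - b^t* *m b + z *: (b^t* *m b).

Fixpoint blaschke_prod (beta : nat -> 'M[K]_(p, p + p)) k (z : K) : 'M[K]_(p + p) :=
  if k is k'.+1 then blaschke_prod beta k' z *m blaschke (beta k') z else 1%:M.

Lemma mx_analytic0_blaschke_prod beta k : mx_analytic0 (blaschke_prod beta k).
Proof.
elim: k => [|k IH] /=; first by move=> i j; exact: analytic0_cst.
apply: mx_analytic0_mul => // i j.
set Q := (beta k)^t* *m beta k.
apply: (@eq_analytic0 _ (fun z => (1%:M - Q) i j + z * Q i j)).
  by move=> z; rewrite !mxE.
apply: analytic0D; first exact: analytic0_cst.
by apply: analytic0M; [exact: analytic0_id|exact: analytic0_cst].
Qed.

Lemma mx_asymptotic_blaschke b q (F : K -> 'M[K]_(p + p, q)) x :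
  mx_asymptotic F x -> mx_asymptotic (fun z => blaschke b z *m F z) (mulBl b x).
Proof.
move=> Fx i j; pose Q := b^t* *m b; pose P := 1%:M - Q.
have lin (A : 'M[K]_(p + p)) : asymptotic (fun z => (A *m F z) i j)
    (fun k => (A *m x k) i j).
  apply: (@eq_asymptotic (fun z => \sum_l A i l * F z l j) _
    (fun k => \sum_l A i l * x k l j)) => [z|k|]; rewrite ?mxE//.
  by apply: asymptotic_sum => l; exact: asymptoticZ.
apply: eq_asymptotic (asymptoticD (lin P) (asymptotic_shift (lin Q))).
  move=> z /=; have -> : blaschke b z *m F z = P *m F z + z *: (Q *m F z).
    by rewrite scalemxAl -mulmxDl.
  by rewrite [RHS]mxE [X in _ = _ + X]mxE.
by move=> [|k]; rewrite /mulBl !mxE ?mulmxA.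
Qed.

Lemma mx_asymptotic_blaschke_prod beta k q (F : K -> 'M[K]_(p + p, q)) x :
  mx_asymptotic F x ->
  mx_asymptotic (fun z => blaschke_prod beta k z *m F z) (mulBs beta k x).
Proof.
elim: k F x => [|k IH] F x Fx /=.
  by move=> i j; apply: eq_asymptotic (Fx i j) => // z; rewrite mul1mx.
move=> i j; apply: eq_asymptotic (IH _ _ (mx_asymptotic_blaschke (beta k) Fx) i j) => // z.
by rewrite mulmxA.
Qed.

Lemma near0_neq0 (z : K) : `|z| <= 2^-1 -> (1 - z != 0) * (1 + z != 0).
Proof.
move=> z2; have z1 : `|z| < 1 by rewrite (le_lt_trans z2)// invf_lt1// ltr1n.
split; first by rewrite subr_eq0; apply: contraTneq z1 => <-; rewrite normr1 ltxx.
rewrite addrC addr_eq0; apply: contraTneq z1 => ->.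
by rewrite normrN normr1 ltxx.
Qed.

Definition cayley_incr (z : K) : K := 2 * 'i * z * (1 - z)^-1.

Lemma cayleyE z : `|z| <= 2^-1 -> cayley z = 'i + cayley_incr z.
Proof.
move=> /near0_neq0[z1 _]; rewrite /cayley /cayley_incr; field; exact: z1.
Qed.

Lemma analytic0_cayley_incr : analytic0 cayley_incr.
Proof.
apply: analytic0M; last exact: analytic0_geometric.
by apply: analytic0M; [exact: analytic0_cst|exact: analytic0_id].
Qed.

Lemma cayley_incr0 : cayley_incr 0 = 0.
Proof. by rewrite /cayley_incr mulr0 mul0r. Qed.

Lemma half_gt0 : 0 < 2^-1 :> K.
Proof. by rewrite invr_gt0. Qed.

Lemma mx_analytic0_cayley m q (F : K -> 'M[K]_(m, q)) :
  analytic_at F 'i -> mx_analytic0 (fun z => F (cayley z)).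
Proof.
move=> [a Fa] i j; have [_ Fan] := taylor_expansion_entry Fa i j.
have := analytic0_comp Fan analytic0_cayley_incr cayley_incr0.
by apply: (analytic0_near half_gt0) => z z2 /=; rewrite cayleyE.
Qed.

(** With Q = b^* b, each factor is 1 + (1 - z)/(1 + z) (1 - 2 Q) = 2/(1 + z) (1 - Q + z Q). The
    adjoint reverses the product, so indices increase from left to right. *)
Lemma calW_cayley n (C : nat -> 'M[K]_(p + p)) beta z :
  discrete_system n C beta -> `|z| <= 2^-1 ->
  calW n C (cayley z) = (2 / (1 + z)) ^+ n.+1 *: blaschke_prod beta n.+1 z.
Proof.
move=> [Ch Cb bb _ _] z2; have [z1 z1'] := near0_neq0 z2.
rewrite /calW; suff : forall k, (k <= n.+1)%N ->
    (fundamental_solution C k (cayley z)^*)^t*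
    = (2 / (1 + z)) ^+ k *: blaschke_prod beta k z by apply.
elim=> [_|k IH kn]; first by rewrite expr0 scale1r /= trmx1 map_mx1.
have {}kn : (k <= n)%N by [].
rewrite /= linearB /= map_mxB /= IH ?leqW// linearZ /= map_mxZ /= adjmx_mul IH ?leqW//.
have -> : (C k)^t* = C k.
  have [/is_hermitianmxP + _ _] := Ch k kn.
  by rewrite expr0 scale1r => <-.
have -> : ('i / (cayley z)^*)^* = - ((1 - z) / (1 + z)).
  rewrite rmorphM /= fmorphV /= conjCK conjCi /cayley mulNr; congr (- _).
  by field; rewrite neq0Ci z1 z1'.
rewrite -scalemxAl scalerA (mulrC (- _)) -scalerA -scalerBr exprSr -scalerA; congr (_ *: _).
rewrite scalemxAr -[X in X - _]mulmx1 -mulmxBr scalemxAr; congr (_ *m _).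
rewrite Cb// /blaschke.
by apply/matrixP => i j; rewrite !mxE; field.
Qed.

Lemma weyl_col n (C : nat -> 'M[K]_(p + p)) R Q l :
  col_mx (weyl_num n C R Q l) (weyl_den n C R Q l) = calW n C l *m col_mx (R l) (Q l).
Proof. by rewrite -[calW n C l in RHS]submxK mul_block_col. Qed.

(** Put T = [R; Q] and let N, D be the blocks of the product applied to T. The scalar power of 2/(1
    + z) cancels in the quotient defining phi, which leaves X = T D^-1. Writing D^-1 as adjugate
    over determinant reduces its analyticity to sums, products and one scalar inverse. *)
Lemma weyl_factor n (C : nat -> 'M[K]_(p + p)) beta phi :
  discrete_system n C beta -> weyl_function n C phi ->
  exists X : K -> 'M[K]_(p + p, p), mx_analytic0 X /\
  exists2 r, 0 < r & forall z, `|z| <= r ->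
    blaschke_prod beta n.+1 z *m X z = col_mx (phi (cayley z)) 1%:M.
Proof.
move=> sysC [R [Q [[Ra Qa den0] /near_radius[rho rho0 phiE]]]].
pose T z := col_mx (R (cayley z)) (Q (cayley z)).
pose N z := usubmx (blaschke_prod beta n.+1 z *m T z).
pose D z := dsubmx (blaschke_prod beta n.+1 z *m T z).
have Ta : mx_analytic0 T.
  move=> i j; rewrite /T.
  have := mx_analytic0_cayley (nbhs_singleton Ra).
  have := mx_analytic0_cayley (nbhs_singleton Qa).
  case: (fintype.splitP i) => k ik Qan Ran.
    apply: eq_analytic0 (Ran k j) => z.
    have -> : i = lshift p k by exact: val_inj.
    by rewrite col_mxEu.
  apply: eq_analytic0 (Qan k j) => z.
  have -> : i = rshift p k by exact: val_inj.
  by rewrite col_mxEd.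
have BTa : mx_analytic0 (fun z => blaschke_prod beta n.+1 z *m T z).
  by apply: mx_analytic0_mul => //; exact: mx_analytic0_blaschke_prod.
have Da : mx_analytic0 D.
  by move=> i j; apply: eq_analytic0 (BTa (rshift p i) j) => z; rewrite [RHS]mxE.
have weylE z : `|z| <= 2^-1 -> exists2 c, c != 0 &
    weyl_num n C R Q (cayley z) = c *: N z /\ weyl_den n C R Q (cayley z) = c *: D z.
  move=> z2; exists ((2 / (1 + z)) ^+ n.+1).
    by rewrite expf_neq0// mulf_neq0 ?pnatr_eq0// invr_eq0 (near0_neq0 z2).
  apply: eq_col_mx; rewrite weyl_col (calW_cayley sysC z2) -scalemxAl.
  by rewrite -scale_col_mx vsubmxK.
have cayley0 : cayley 0 = 'i :> K by rewrite /cayley addr0 subr0 divr1 mulr1.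
have D0 : \det (D 0) != 0.
  have [|c c0 [_ DE]] := weylE 0; first by rewrite normr0 ltW// half_gt0.
  by move: den0; rewrite -cayley0 DE detZ mulf_eq0 negb_or => /andP[].
have [r1 r10 Dr] := analytic0_neq0 (analytic0_det Da) D0.
have [r2 [M [r20 M0 incrM]]] := analytic0_small analytic0_cayley_incr cayley_incr0.
have [r3 r30 [r31 r3h]] := pos_lower_bound r10 half_gt0.
(* M |z| <= rho / 2 keeps [cayley z] within the radius rho around i on which the formula for phi
   holds. *)
have [r4 r40 [r42 r4M]] := pos_lower_bound r20 (divr_gt0 rho0 (addr_gt0 M0 M0)).
have [r r0 [rr3 rr4]] := pos_lower_bound r30 r40.
exists (fun z => (\det (D z))^-1 *: (T z *m \adj (D z))); split.
  move=> i j.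
  apply: (@eq_analytic0 _ (fun z => (\det (D z))^-1 * (T z *m \adj (D z)) i j)).
    by move=> z; rewrite [RHS]mxE.
  apply: analytic0M; first exact/analytic0V/D0/analytic0_det.
  by apply: mx_analytic0_mul => //; exact: mx_analytic0_adj.
exists r => // z zr.
have z2 : `|z| <= 2^-1 by rewrite (le_trans zr)// (le_trans rr3).
have Dz : D z \in unitmx.
  by rewrite unitmxE unitfE Dr// (le_trans zr)// (le_trans rr3).
have incr : `|cayley_incr z| < rho.
  rewrite (le_lt_trans (incrM z _)) ?(le_trans zr) ?(le_trans rr4)//.
  rewrite (@le_lt_trans _ _ (M * (rho / (M + M)))) ?ler_wpM2l ?(ltW M0)//.
    by rewrite (le_trans zr)// (le_trans rr4).
  rewrite mulrCA gtr_pMr// ltr_pdivrMr ?addr_gt0// mul1r ltrDl.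
  exact: M0.
rewrite cayleyE// phiE// -cayleyE//.
have [c c0 [-> DE]] := weylE z z2; rewrite DE.
have cu : c *: D z \in unitmx.
  by rewrite unitmxE detZ unitrM !unitfE expf_neq0//= -unitfE -unitmxE.
have -> : c *: N z *m invmx (c *: D z) = N z *m invmx (D z).
  by rewrite invmxZ// -scalemxAl -scalemxAr scalerA divff// scale1r.
rewrite -scalemxAr mulmxA.
have -> : (\det (D z))^-1 *: (blaschke_prod beta n.+1 z *m T z *m \adj (D z))
    = blaschke_prod beta n.+1 z *m T z *m invmx (D z).
  by rewrite [invmx _]/invmx Dz -scalemxAr.
rewrite -[blaschke_prod _ _ _ *m _]vsubmxK -/(N z) -/(D z) mul_col_mx.
by rewrite mulmxV.
Qed.

(** The product applied to X and the column [phi; I] are the same germ, so uniqueness of asymptotic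
    expansions identifies their coefficients. From here on only formal series matter. *)
Lemma weyl_col_asymptotic n (C : nat -> 'M[K]_(p + p)) beta phi alpha :
  discrete_system n C beta -> weyl_function n C phi ->
  taylor_expansion (fun z => phi (cayley z)) 0 alpha ->
  exists x : nat -> 'M[K]_(p + p, p), mulBs beta n.+1 x =1 graph_col alpha.
Proof.
move=> sysC phiW phiT.
have [X [Xa [r r0 XE]]] := weyl_factor sysC phiW.
have [x xE] := choice (fun ij => analytic0_expansion (Xa ij.1 ij.2)).
pose y k : 'M[K]_(p + p, p) := \matrix_(i, j) x (i, j) k.
have Xy : mx_asymptotic X y.
  move=> i j; apply: eq_asymptotic (expansion_asymptotic (xE (i, j))) => // k.
  by rewrite mxE.
exists y => k; apply/matrixP => i j.
have := mx_asymptotic_blaschke_prod beta n.+1 Xy i j.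
have {}XE z : `|z| <= r -> (blaschke_prod beta n.+1 z *m X z) i j
    = col_mx (phi (cayley z)) 1%:M i j by move=> /XE ->.
move=> /(asymptotic_near r0 XE) Yx; pose g k := graph_col alpha k i j.
apply: (asymptotic_unique Yx (b := g)); rewrite {}/g.
have phia l : asymptotic (fun z => phi (cayley z) l j) (fun k => alpha k l j).
  have [phil _] := taylor_expansion_entry phiT l j.
  apply: eq_asymptotic (expansion_asymptotic phil) => // z.
  by rewrite add0r.
case: (fintype.splitP i) => l il.
  have -> : i = lshift p l by exact: val_inj.
  by apply: eq_asymptotic (phia l) => [z|k']; rewrite ?/graph_col col_mxEu.
have -> : i = rshift p l by exact: val_inj.
apply: eq_asymptotic (asymptotic_cst ((l == j)%:R : K)) => [z|k'].
  by rewrite col_mxEd mxE.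
by rewrite /graph_col col_mxEd !mxE mulr_natr.
Qed.

End WeylFunctions.

(** * Analyticity and recovery over R[i] *)

Lemma weyl_cayley_analytic (R : realType) n p (C : nat -> 'M[R[i]]_(p + p))
    (beta : nat -> 'M[R[i]]_(p, p + p)) phi :
  discrete_system n C beta -> weyl_function n C phi ->
  analytic_at (fun z => phi (cayley z)) 0.
Proof.
move=> sysC phiW; have [X [Xa [r r0 XE]]] := weyl_factor sysC phiW.
have phia ij : analytic0 (fun z => phi (cayley z) ij.1 ij.2).
  have := mx_analytic0_mul (mx_analytic0_blaschke_prod beta n.+1) Xa
    (lshift p ij.1) ij.2.
  by apply: (analytic0_near r0) => z /XE ->; rewrite col_mxEu.
have [x xE] := choice (fun ij => analytic0_expansion (phia ij)).
exists (fun k => \matrix_(i, j) x (i, j) k).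
apply: expansion_taylor => [M e|i j]; first exact: geometric_small.
have [s [M [s0 sM]]] := xE (i, j); exists s, M; split => // m z zs.
by under eq_bigr do rewrite mxE; exact: sM.
Qed.

Theorem theorem3p4 (R : realType) (n p : nat) (p_gt0 : (0 < p)%N)
    (C : nat -> 'M[R[i]]_(p + p)) (beta : nat -> 'M[R[i]]_(p, p + p))
    (sysC : discrete_system n C beta)
    (phi : R[i] -> 'M[R[i]]_p) (phiW : weyl_function n C phi) :
  analytic_at (fun z => phi (cayley z)) 0
  /\
  forall alpha : nat -> 'M[R[i]]_p,
    taylor_expansion (fun z => phi (cayley z)) 0 alpha ->
    (* the procedure, at every level m <= n *)
    (forall m, (m <= n)%N ->
      exists S : 'M[R[i]]_(\sum_(i < m.+1) p),
        [/\ S_identity alpha S,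
            forall S', S_identity alpha S' -> S' = S,
            S \in unitmx,
            posdefmx S
          & (Pimx m alpha) ^t* *m invmx S *m Pimx m alpha
            = (Bmx m beta) ^t* *m Bmx m beta])
    /\
    (* the system is determined by the first n + 1 Taylor coefficients *)
    (forall (C' : nat -> 'M[R[i]]_(p + p)) (beta' : nat -> 'M[R[i]]_(p, p + p))
            (phi' : R[i] -> 'M[R[i]]_p) (alpha' : nat -> 'M[R[i]]_p),
      discrete_system n C' beta' ->
      weyl_function n C' phi' ->
      taylor_expansion (fun z => phi' (cayley z)) 0 alpha' ->
      (forall k, (k <= n)%N -> alpha' k = alpha k) ->
      forall k, (k <= n)%N ->
        (beta' k) ^t* *m beta' k = (beta k) ^t* *m beta k /\ C' k = C k).
Proof.
split; first exact: weyl_cayley_analytic sysC phiW.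
move=> alpha phiT.
have level C1 beta1 phi1 alpha1 m : discrete_system n C1 beta1 ->
    weyl_function n C1 phi1 ->
    taylor_expansion (fun z => phi1 (cayley z)) 0 alpha1 -> (m <= n)%N ->
    exists S : 'M[R[i]]_(\sum_(i < m.+1) p),
    [/\ S_identity alpha1 S, forall S', S_identity alpha1 S' -> S' = S,
      S \in unitmx, posdefmx S
    & (Pimx m alpha1) ^t* *m invmx S *m Pimx m alpha1
      = (Bmx m beta1) ^t* *m Bmx m beta1].
  move=> sys1 W1 T1; apply: recovery_level; last exact: weyl_col_asymptotic sys1 W1 T1.
  by case: sys1.
split=> [m|C' beta' phi' alpha' sys' W' T' aE k kn]; first exact: level sysC phiW phiT.
(* B^* B at level m is only the sum of the b_i^* b_i with i <= m. Equality at every level is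
   therefore needed: cancelling level k - 1 from level k isolates the term of index k. *)
have BB m : (m <= n)%N ->
    (Bmx m beta')^t* *m Bmx m beta' = (Bmx m beta)^t* *m Bmx m beta.
  move=> mn; have [S [Sid Suniq _ _ <-]] := level _ _ _ _ m sysC phiW phiT mn.
  have [S' [Sid' _ _ _ <-]] := level _ _ _ _ m sys' W' T' mn.
  have PE : Pimx m alpha' = Pimx m alpha.
    congr (row_mx _ (- _)); apply: eq_mxcol => i.
    rewrite !big_mkord; apply: eq_bigr => j _; apply: aE.
    by rewrite (leq_trans _ mn)// -ltnS (leq_trans (ltn_ord j)).
  by move: Sid'; rewrite /S_identity PE => /Suniq ->.
have Bsum (b : nat -> 'M[R[i]]_(p, p + p)) m :
    (Bmx m b)^t* *m Bmx m b = \sum_(i < m.+1) (b i)^t* *m b i.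
  by rewrite /Bmx tr_mxcol map_mxrow mul_mxrow_mxcol.
have bb : (beta' k)^t* *m beta' k = (beta k)^t* *m beta k.
  have := BB k kn; rewrite !Bsum !big_ord_recr /=.
  case: k kn => [|k] kn; first by rewrite !big_ord0 !add0r.
  by rewrite -!Bsum (BB k (ltnW kn)) => /addrI.
split=> //.
have [_ CE _ _ _] := sysC; have [_ CE' _ _ _] := sys'.
by rewrite CE// CE'// bb.
Qed.
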